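(* Let $\varphi$ be an onto endomorphism of a subshift $(X,\sigma)$. (1) $\varphi$ is essentially weakly $p$-L and right $\sigma$-expansive if and only if $\varphi$ is right $\sigma$-expansive on the upper side; and $\varphi$ is essentially weakly $p$-R and left $\sigma$-expansive if and only if $\varphi$ is left $\sigma$-expansive on the upper side. (2) If $(X,\sigma)$ is an SFT, then (1) holds with every ''weakly'' deleted.
   Context: **Subshifts.** An alphabet is a finite set with at least two elements. For an alphabet $A$, $A^{\mathbb Z}$ carries the product topology; the shift maps $(a_j)_j$ to $(a_{j+1})_j$. A subshift $(X,\sigma)$ over $A$ is a closed $X\subset A^{\mathbb Z}$ with $\sigma(X)=X$, $\sigma$ being the restricted shift; $d_X$ is a compatible metric. An endomorphism of $(X,\sigma)$ is a continuous map $\varphi:X\to X$ commuting with $\sigma$. **Graphs.** A graph is a finite directed graph $G$ (multiple arcs, loops allowed) with arc-set $A_G$, vertex-set $V_G$ and initial/terminal vertex maps $i_G,t_G:A_G\to V_G$; it is nondegenerate if $i_G,t_G$ are onto. $X_G\subset A_G^{\mathbb Z}$ is the set of bi-infinite paths ($t_G(a_j)=i_G(a_{j+1})$ for all $j$) and $\sigma_G$ its shift; for $G$ nondegenerate, $(X_G,\sigma_G)$ is called a topological Markov shift. An SFT is a subshift topologically conjugate to a topological Markov shift. A graph-homomorphism $h=(h_A,h_V):\Gamma\to G$ is a pair of maps on arcs and vertices compatible with $i,t$; it induces $\phi_h:X_\Gamma\to X_G$, $(\alpha_j)\mapsto(h_A(\alpha_j))$. $h$ is weakly left-resolving (resp.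 weakly right-resolving) if every arc $\alpha$ of $\Gamma$ is uniquely determined by $t_\Gamma(\alpha)$ (resp. $i_\Gamma(\alpha)$) and $h_A(\alpha)$; it is left-resolving (resp. right-resolving) if for every $u\in V_\Gamma$, $a\in A_G$ with $t_G(a)=h_V(u)$ (resp. $i_G(a)=h_V(u)$) there is a unique $\alpha\in A_\Gamma$ with $h_A(\alpha)=a$ and $t_\Gamma(\alpha)=u$ (resp. $i_\Gamma(\alpha)=u$). **Resolving endomorphisms.** A textile system $T=(p,q:\Gamma\to G)$ is a pair of graph-homomorphisms $p,q:\Gamma\to G$. $T$ is (weakly) $p$-L if $p$ is (weakly) left-resolving, (weakly) $p$-R if $p$ is (weakly) right-resolving. For each of these terms $\mathcal P$: an endomorphism $\varphi$ of a subshift $(X,\sigma)$ is weakly $\mathcal P$ if there are a weakly $\mathcal P$ textile system $T=(p,q:\Gamma\to G)$ and a closed shift-invariant $Z\subset X_\Gamma$ such that $\phi_p|_Z$ is injective, $\phi_p(Z)=X$, $\phi_q(Z)\subset X$ and $\varphi=\phi_q\circ(\phi_p|_Z)^{-1}$. An onto endomorphism $\varphi$ of a topological Markov shift $(X_G,\sigma_G)$ is $\mathcal P$ if there is a $\mathcal P$ textile system $T=(p,q:\Gamma\to G)$ such that, with $Z_T$ the set of $z\in X_\Gamma$ for which there is $(z_i)_{i\in\mathbb Z}$ in $X_\Gamma$ with $z_0=z$ and $\phi_q(z_{i-1})=\phi_p(z_i)$ for all $i$, one has $\phi_p(Z_T)=X_G$, $\phi_p|_{Z_T}$ is injective and $\varphi=\phi_q\circ(\phi_p|_{Z_T})^{-1}$.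 An endomorphism $\varphi$ of $(X,\sigma)$ is essentially weakly $\mathcal P$ (resp. an onto endomorphism of an SFT is essentially $\mathcal P$) if there are a subshift (resp. topological Markov shift) $(X',\sigma')$, a weakly $\mathcal P$ (resp. $\mathcal P$) endomorphism $\varphi'$ of it and a homeomorphism $\theta:X\to X'$ with $\theta\sigma=\sigma'\theta$, $\theta\varphi=\varphi'\theta$. **Expansiveness.** A $\varphi$-orbit is a sequence $(x_i)_{i\in\mathbb Z}$ with $\varphi(x_i)=x_{i+1}$. An onto endomorphism $\varphi$ is left (resp. right) $\sigma$-expansive if there is $\delta>0$ such that for any $\varphi$-orbits $(x_i),(y_i)$, $d_X(\sigma^j(x_i),\sigma^j(y_i))\le\delta$ for all $i\in\mathbb Z$ and all $j\le0$ (resp. $j\ge0$) implies $(x_i)_{i\in\mathbb Z}=(y_i)_{i\in\mathbb Z}$. It is left (resp. right) $\sigma$-expansive on the upper side if there is $\delta>0$ such that for any $\varphi$-orbits $(x_i),(y_i)$, $d_X(\sigma^j(x_i),\sigma^j(y_i))\le\delta$ for all $i\le0$ and all $j\le0$ (resp. $j\ge0$) implies $(x_i)_{i\in\mathbb Z}=(y_i)_{i\in\mathbb Z}$. *)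

(* Defs.v *)
From HB Require Import structures.
From mathcomp Require Import all_boot all_order all_algebra.
From mathcomp Require Import all_classical reals topology function_spaces.

Set Implicit Arguments.
Unset Strict Implicit.
Unset Printing Implicit Defensive.

Import Order.TTheory GRing.Theory Num.Theory.
Local Open Scope classical_set_scope.
Local Open Scope ring_scope.

(** * Subshifts *)

Definition fullshift (A : finType) : Type := {ptws int -> discrete_topology A}.

HB.instance Definition _ (A : finType) := Topological.on (fullshift A).

(* The [j]-th power of the shift map, for [j] an arbitrary integer. *)
Definition shift (A : finType) (j : int) (x : fullshift A) : fullshift A :=
  fun k => x (k + j).

(* The requirement that an alphabet has at least two symbols is not part of
   this record, but is stated wherever an alphabet is quantified: the arc-set
   of a graph may well have fewer than two elements. *)
Record subshift (A : finType) := Subshift {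
  points :> set (fullshift A);
  closed_points : closed points;
  shift_points : shift 1 @` points = points }.

Lemma shiftD (A : finType) (i j : int) (x : fullshift A) :
  shift i (shift j x) = shift (i + j) x.
Proof. by apply/funext => k; rewrite /shift addrA. Qed.

Lemma shift0 (A : finType) (x : fullshift A) : shift 0 x = x.
Proof. by apply/funext => k; rewrite /shift addr0. Qed.

Lemma shift_mem (A : finType) (X : subshift A) (j : int) (x : fullshift A) :
  x \in points X -> shift j x \in points X.
Proof.
rewrite !inE => Xx.
have fwd y : points X y -> points X (shift 1 y).
  by move=> Xy; rewrite -(shift_points X); exists y.
have bwd y : points X y -> points X (shift (-1) y).
  by rewrite -{1}(shift_points X) => -[z Xz <-]; rewrite shiftD addNr shift0.
elim/int_ind: j => [|n IH|n IH]; first by rewrite shift0.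
- by rewrite -[n.+1]addn1 PoszD addrC -shiftD; apply: fwd.
- by rewrite -[n.+1]addn1 PoszD opprD addrC -shiftD; apply: bwd.
Qed.

(* The [j]-th power of the shift restricted to [X]. *)
Definition shift_on (A : finType) (X : subshift A) (j : int) (x : X) : X :=
  exist _ (shift j (val x)) (shift_mem j (valP x)).

Definition endomorphism (A : finType) (X : subshift A) (phi : X -> X) : Prop :=
  continuous phi /\ forall x, phi (shift_on 1 x) = shift_on 1 (phi x).

Definition onto (S T : Type) (f : S -> T) : Prop := forall y, exists x, f x = y.

Definition homeomorphism (S T : topologicalType) (f : S -> T) : Prop :=
  continuous f /\
  exists g : T -> S, [/\ continuous g, cancel f g & cancel g f].

Definition conjugacy (A B : finType) (X : subshift A) (Y : subshift B)
    (theta : X -> Y) : Prop :=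
  homeomorphism theta /\
  forall x, theta (shift_on 1 x) = shift_on 1 (theta x).

Record compatible_metric (R : realType) (T : topologicalType)
    (d : T -> T -> R) : Prop := CompatibleMetric {
  dist_eq0 : forall x y, d x y = 0 <-> x = y;
  dist_sym : forall x y, d x y = d y x;
  dist_triangle : forall x y z, d x z <= d x y + d y z;
  dist_nbhs : forall x (U : set T),
    nbhs x U <-> exists2 e : R, 0 < e & [set y | d x y < e] `<=` U }.

(** * Graphs and textile systems *)

(* A graph is given over its arc-set [A]. *)
Record graph (A : finType) := Graph {
  vertex : finType;
  ini : A -> vertex;
  ter : A -> vertex }.

Definition nondegenerate (A : finType) (G : graph A) : Prop :=
  onto (@ini A G) /\ onto (@ter A G).

Definition paths (A : finType) (G : graph A) : set (fullshift A) :=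
  [set a | forall j : int, ter G (a j) = ini G (a (j + 1))].

Lemma closed_paths (A : finType) (G : graph A) : closed (paths G).
Proof.
move=> a cla j.
pose pr (k : int) (b : fullshift A) : discrete_topology A := b k.
have pr_nbhs k : nbhs a [set b | b k = a k].
  apply: (@proj_continuous int (fun=> discrete_topology A) k a [set a k]).
  exact: discrete_set1.
have [b [Gb [/= <- <-]]] := cla _ (filterI (pr_nbhs j) (pr_nbhs (j + 1))).
exact: Gb.
Qed.

Lemma shift_paths (A : finType) (G : graph A) : shift 1 @` paths G = paths G.
Proof.
apply/seteqP; split => [_ [a Ga <-] j|a Ga]; first exact: Ga.
exists (shift (-1) a); last by rewrite shiftD subrr shift0.
by move=> j; rewrite /shift addrAC; apply: Ga.
Qed.

(* X_G; it is a topological Markov shift when [G] is nondegenerate. *)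
Definition path_shift (A : finType) (G : graph A) : subshift A :=
  Subshift (@closed_paths A G) (@shift_paths A G).

Definition SFT (A : finType) (X : subshift A) : Prop :=
  exists (B : finType) (G : graph B) (theta : X -> path_shift G),
    nondegenerate G /\ conjugacy theta.

Record graph_hom (B A : finType) (Gamma : graph B) (G : graph A) := GraphHom {
  arc_map : B -> A;
  vertex_map : vertex Gamma -> vertex G;
  ini_map : forall b, ini G (arc_map b) = vertex_map (ini Gamma b);
  ter_map : forall b, ter G (arc_map b) = vertex_map (ter Gamma b) }.

(* The one-block map phi_h, on all sequences of arcs of [Gamma]. *)
Definition block_map (B A : finType) (Gamma : graph B) (G : graph A)
    (h : graph_hom Gamma G) (z : fullshift B) : fullshift A :=
  fun j => arc_map h (z j).

Section Resolving.
Variables (B A : finType) (Gamma : graph B) (G : graph A).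
Variable h : graph_hom Gamma G.

Definition weakly_left_resolving : Prop := forall b c : B,
  ter Gamma b = ter Gamma c -> arc_map h b = arc_map h c -> b = c.

Definition weakly_right_resolving : Prop := forall b c : B,
  ini Gamma b = ini Gamma c -> arc_map h b = arc_map h c -> b = c.

Definition left_resolving : Prop := forall (u : vertex Gamma) (a : A),
  ter G a = vertex_map h u ->
  exists! b : B, arc_map h b = a /\ ter Gamma b = u.

Definition right_resolving : Prop := forall (u : vertex Gamma) (a : A),
  ini G a = vertex_map h u ->
  exists! b : B, arc_map h b = a /\ ini Gamma b = u.

End Resolving.

Record textile (B A : finType) (Gamma : graph B) (G : graph A) := Textile {
  tp : graph_hom Gamma G;
  tq : graph_hom Gamma G }.

Definition textile_property : Type :=
  forall (B A : finType) (Gamma : graph B) (G : graph A),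
    textile Gamma G -> Prop.

Definition weakly_pL : textile_property :=
  fun _ _ _ _ T => weakly_left_resolving (tp T).
Definition weakly_pR : textile_property :=
  fun _ _ _ _ T => weakly_right_resolving (tp T).
Definition pL : textile_property := fun _ _ _ _ T => left_resolving (tp T).
Definition pR : textile_property := fun _ _ _ _ T => right_resolving (tp T).

(** * Resolving endomorphisms *)

(* phi_p is injective on [Z] and maps it onto [X], phi_q maps [Z] into [X],
   and phi = phi_q \o (phi_p|_Z)^-1. *)
Definition represents (B A : finType) (Gamma : graph B) (G : graph A)
    (T : textile Gamma G) (Z : set (fullshift B)) (X : subshift A)
    (phi : X -> X) : Prop :=
  [/\ {in Z &, injective (block_map (tp T))},
      block_map (tp T) @` Z = X,
      block_map (tq T) @` Z `<=` X &
      forall (z : fullshift B) (x : X), Z z -> block_map (tp T) z = val x ->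
        val (phi x) = block_map (tq T) z].

(* To be used with the weakly resolving properties. That the arc-set of [G] is
   the alphabet [A] of [X] is no restriction: arcs of [G] that do not occur
   in [X], together with the arcs of [Gamma] above them, play no role, and may
   be removed or added at will. *)
Definition weak_endo (P : textile_property) (A : finType) (X : subshift A)
    (phi : X -> X) : Prop :=
  exists (B : finType) (Gamma : graph B) (G : graph A) (T : textile Gamma G)
      (Z : subshift B),
    [/\ P _ _ _ _ T, Z `<=` paths Gamma & represents T Z phi].

(* Z_T: the zeroth rows of the two-dimensional textiles woven by [T]. *)
Definition woven (B A : finType) (Gamma : graph B) (G : graph A)
    (T : textile Gamma G) : set (fullshift B) :=
  [set z | exists zs : int -> fullshift B,
    [/\ forall i, paths Gamma (zs i), zs 0 = z &
        forall i, block_map (tq T) (zs (i - 1)) = block_map (tp T) (zs i)]].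

(* To be used with the resolving properties, for an onto endomorphism [phi] of
   X_G. *)
Definition strong_endo (P : textile_property) (A : finType) (G : graph A)
    (phi : path_shift G -> path_shift G) : Prop :=
  exists (B : finType) (Gamma : graph B) (T : textile Gamma G),
    P _ _ _ _ T /\ represents T (woven T) phi.

Definition essentially_weakly (P : textile_property) (A : finType)
    (X : subshift A) (phi : X -> X) : Prop :=
  exists (A' : finType) (X' : subshift A') (phi' : X' -> X') (theta : X -> X'),
    [/\ (1 < #|A'|)%N, endomorphism phi', weak_endo P phi', conjugacy theta &
        forall x, theta (phi x) = phi' (theta x)].

Definition essentially (P : textile_property) (A : finType) (X : subshift A)
    (phi : X -> X) : Prop :=
  exists (A' : finType) (G : graph A')
      (phi' : path_shift G -> path_shift G) (theta : X -> path_shift G),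
    [/\ nondegenerate G, endomorphism phi' /\ onto phi', strong_endo P phi',
        conjugacy theta & forall x, theta (phi x) = phi' (theta x)].

(** * Expansiveness *)

Definition orbit_of (S : Type) (phi : S -> S) (x : int -> S) : Prop :=
  forall i, phi (x i) = x (i + 1).

(* Two [phi]-orbits that stay [delta]-close at all the sites (i, j) with [I i]
   and [J j] coincide, where the site (i, j) of an orbit carries
   sigma^j (x_i). *)
Definition expansive_on (R : realType) (I J : set int) (A : finType)
    (X : subshift A) (d : X -> X -> R) (phi : X -> X) : Prop :=
  exists2 delta : R, 0 < delta &
    forall x y : int -> X, orbit_of phi x -> orbit_of phi y ->
      (forall i j, I i -> J j ->
        d (shift_on j (x i)) (shift_on j (y i)) <= delta) ->
      x = y.

Section Expansive.
Variables (R : realType) (A : finType) (X : subshift A).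
Variables (d : X -> X -> R) (phi : X -> X).

Definition left_expansive : Prop :=
  expansive_on setT [set j | j <= 0] d phi.
Definition right_expansive : Prop :=
  expansive_on setT [set j | 0 <= j] d phi.
Definition left_expansive_upper : Prop :=
  expansive_on [set i | i <= 0] [set j | j <= 0] d phi.
Definition right_expansive_upper : Prop :=
  expansive_on [set i | i <= 0] [set j | 0 <= j] d phi.

End Expansive.

(* Main.v *)
Require Import Defs.
From mathcomp Require Import all_boot all_order all_algebra.
From mathcomp Require Import all_classical reals topology function_spaces.
From mathcomp Require Import zify.

Set Implicit Arguments.
Unset Strict Implicit.
Unset Printing Implicit Defensive.

(** Place an orbit (x_i) of phi in the plane, with the letter x_i(j) in row i
    and column j. Expansiveness then says that the letters in a half-plane or
    in a quadrant determine the whole orbit ([expansive_onP]), and by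
    compactness any one letter is already determined by finitely many letters
    of that region ([determining_window]). The metric and the topology
    disappear from the argument: a continuous map commuting with the shift is a
    sliding block code ([continuous_block_codeP]).

    From resolving to the upper side ([weakly_pL_upper]). Let two orbits carry
    the same letters in the quadrant i <= 0, j >= 0, and lift each row x_i to
    its path z_i in Gamma. The lifts agree in the rows i <= 0 far enough to the
    right, and this agreement extends to the left column by column. Right
    expansiveness gives the letters of the next column c only in the rows up to
    - n, since its window reaches n rows up and down. The left-resolving map p
    makes good for this loss: the arc z_i(c) is known from its label x_i(c) and
    from its terminal vertex, which is the initial vertex of z_i(c + 1); its
    image under q is x_{i+1}(c). So knowledge of column c climbs from row - n
    up to row 0, and finally all rows i <= 0 agree everywhere.

    From the upper side to resolving. Now x_1(0) is determined by the letters
    in the rows - n .. 0 and the columns 0 .. n. Replacing x by the stack of x,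
    phi x, .., phi^n x conjugates phi to an endomorphism psi that is one-sided:
    psi(y)(0) depends only on y(0), .., y(m) for some m ([upper_one_sided]).
    Let the arcs of Gamma be the words of length m + 1 and its vertices the
    words of length m, let p read the first letter of a word and q the letter
    of psi that the word determines. An arc is then recovered from its first
    letter and from its terminal vertex, which consists of its remaining
    letters, so p is weakly left-resolving ([one_sided_weakly_pL]).

    For an SFT the stacked subshift is given by forbidding finitely many words
    ([conj_finite_type]), so coding it by longer words makes it an X_G
    ([finite_type_code]). For a one-sided psi on X_G the same Gamma works over
    G itself: two paths of G meeting at a vertex can be glued, which gives the
    existence part of left-resolving ([first_hom_left_resolving]) and shows
    that the initial vertex of the arc psi(x)(0) depends only on the first m
    letters, so that q is defined on vertices ([one_sided_vertex]).

    The statements about p-R follow from those about p-L by reversing the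
    columns ([mirror_iff]). *)

Import Order.TTheory GRing.Theory Num.Theory.
Local Open Scope classical_set_scope.
Local Open Scope ring_scope.

(** * Cylinders as neighbourhoods *)

Definition agree (A : Type) (k : nat) (x y : int -> A) : Prop :=
  forall j : int, (`|j| <= k)%N -> x j = y j.

Lemma agree_leq (A : Type) (k l : nat) (x y : int -> A) :
  (k <= l)%N -> agree l x y -> agree k x y.
Proof. by move=> kl xy j jk; apply/xy/(leq_trans jk). Qed.

Lemma agree_shift (A : finType) (k l : nat) (j : int) (x y : fullshift A) :
  (`|j| + k <= l)%N -> agree l x y -> agree k (shift j x) (shift j y).
Proof. by move=> jkl xy i ik; apply: xy; lia. Qed.

Lemma fullshift_coord_nbhs (A : finType) (x : fullshift A) (j : int) :
  nbhs x [set y : fullshift A | y j = x j].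
Proof.
apply: (@proj_continuous int (fun=> discrete_topology A) j x [set x j]).
exact: discrete_set1.
Qed.

#[local] Instance fullshift_nbhs_filter (A : finType) (x : fullshift A) :
  Filter (nbhs x) := @nbhs_filter (fullshift A : topologicalType) x.

Lemma fullshift_nbhsP (A : finType) (x : fullshift A) (U : set (fullshift A)) :
  nbhs x U <-> exists k, forall y, agree k x y -> U y.
Proof.
split=> [|[k kU]].
  pose cyl := [set V : set (fullshift A) | exists k, agree k x `<=` V].
  (* The filter of cylinders around x converges to x coordinatewise, hence it
     contains all neighbourhoods of x. *)
  have cylF : Filter cyl.
    split; first by exists 0%N.
    - move=> V W [k kV] [l lW]; exists (maxn k l) => y xy; split.
        by apply/kV/(agree_leq _ xy)/leq_maxl.
      by apply/lW/(agree_leq _ xy)/leq_maxr.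
    - by move=> V W VW [k kV]; exists k => y /kV /VW.
  suff : cyl `=>` nbhs x by exact.
  apply/cvg_sup => j; apply/cvg_image => [|V].
    by apply/seteqP; split=> // a _; exists (fun=> a).
  move=> Vx; exists [set y | V (y j)].
    by exists `|j|%N => y xy /=; rewrite -(xy j)//; exact: nbhs_singleton.
  by apply/seteqP; split=> [_ [y Vy <-]//|a Va]; exists (fun=> a).
have xk : nbhs x [set y : fullshift A | agree k x y].
  elim: k {kU} => [|k IH].
    apply: filterS (fullshift_coord_nbhs x 0) => y yx j; rewrite leqn0 absz_eq0.
    by move=> /eqP ->.
  have xk : nbhs x ([set y : fullshift A | agree k x y] `&`
      ([set y : fullshift A | y (Posz k.+1) = x (Posz k.+1)] `&`
       [set y : fullshift A | y (- (Posz k.+1)) = x (- (Posz k.+1))])).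
    by apply: filterI => //; apply: filterI; exact: fullshift_coord_nbhs.
  apply: filterS xk => y [xy [/= yp yn]] j; rewrite leq_eqVlt => /orP[/eqP jk|].
    have [->//|->//] : j = Posz k.+1 \/ j = - Posz k.+1 by lia.
  exact: xy.
exact: filterS xk.
Qed.

Lemma subshift_nbhsP (A : finType) (X : subshift A) (x : X) (U : set X) :
  nbhs x U <-> exists k, forall y : X, agree k (val x) (val y) -> U y.
Proof.
split=> [|[k kU]].
  have /= -> := @nbhsE (initial_topology (@set_val _ (points X))) x.
  move=> -[B [[C oC <-] Cx] BU].
  have /fullshift_nbhsP[k kC] : nbhs (val x) C by exact: open_nbhs_nbhs.
  by exists k => y xy; apply/BU/kC.
have xk : nbhs (val x) [set y : fullshift A | agree k (val x) y].
  by apply/fullshift_nbhsP; exists k.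
have xk' : nbhs x [set y : X | agree k (val x) (val y)].
  exact: (@initial_continuous _ _ (@set_val _ (points X)) x _ xk).
by apply: (@filterS _ (nbhs x) _ _ _ _ xk') => y; exact: kU.
Qed.

(** * Limits along an ultrafilter, and compactness *)

Lemma ultrafilter_ex : exists U : set_system nat, UltraFilter U /\ \oo `<=` U.
Proof. exact: (ultraFilterLemma eventually_filter). Qed.

(** Fixing one nonprincipal ultrafilter turns compactness into the statement
    that every sequence has a limit, with no passage to subsequences: several
    sequences, even infinitely many, converge along the same indices. *)
Definition usually : set_system nat := projT1 (cid ultrafilter_ex).

#[local] Instance usually_ultra : UltraFilter usually.
Proof. by rewrite /usually; case: cid => U []. Qed.

#[local] Instance usually_proper : ProperFilter usually := ultra_proper.

Lemma usually_ge (k : nat) : usually [set n | (k <= n)%N].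
Proof.
rewrite /usually; case: cid => U [/= _ ooU]; apply: ooU; exact: nbhs_infty_ge.
Qed.

Lemma usually_ex2 (P Q : set nat) :
  usually P -> usually Q -> exists n, P n /\ Q n.
Proof. by move=> uP uQ; exact: filter_ex (filterI uP uQ). Qed.

Lemma usually_ex3 (P Q S : set nat) :
  usually P -> usually Q -> usually S -> exists n, [/\ P n, Q n & S n].
Proof.
move=> uP uQ uS; have [n [[Pn Qn] Sn]] := usually_ex2 (filterI uP uQ) uS.
by exists n.
Qed.

Lemma ulim_ex (A : finType) (u : nat -> A) : {a | usually [set n | u n = a]}.
Proof.
apply: cid; apply: contrapT => nu.
suff /filter_ex[n /(_ (u n))] : usually [set n | forall a, u n <> a] by [].
apply: filter_forall => a.
by have [ua|] := in_ultra_setVsetC [set n | u n = a] usually_ultra;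
  [case: nu; exists a|].
Qed.

Definition ulim (A : finType) (u : nat -> A) : A := projT1 (ulim_ex u).

Lemma ulimP (A : finType) (u : nat -> A) : usually [set n | u n = ulim u].
Proof. by rewrite /ulim; case: ulim_ex. Qed.

Definition pointwise_ulim (A : finType) (u : nat -> fullshift A) : fullshift A :=
  fun j => ulim (fun n => u n j).

Lemma pointwise_ulimP (A : finType) (u : nat -> fullshift A) (k : nat) :
  usually [set n | agree k (u n) (pointwise_ulim u)].
Proof.
elim: k => [|k IH].
  apply: filterS (ulimP (fun n => u n 0)) => n /= un j; rewrite leqn0 absz_eq0.
  by move=> /eqP ->.
apply: filterS (filterI IH (filterI (ulimP (fun n => u n (Posz k.+1)))
                                    (ulimP (fun n => u n (- Posz k.+1))))).
move=> n [/= uk [up un]] j; rewrite leq_eqVlt => /orP[/eqP jk|]; last exact: uk.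
by have [->//|->//] : j = Posz k.+1 \/ j = - Posz k.+1 by lia.
Qed.

(** In the converse direction, a point of the closure is approached by taking
    the n-th point within the cylinder of radius n. *)
Lemma closed_ulim (A : finType) (X : set (fullshift A)) :
  closed X <-> forall (u : nat -> fullshift A) (x : fullshift A),
    (forall n, X (u n)) ->
    (forall k, usually [set n | agree k (u n) x]) -> X x.
Proof.
split=> [clX u x uX ux|limX x clx].
  apply: clX => V /fullshift_nbhsP[k kV].
  have /filter_ex[n /= un] := ux k; exists (u n); split; first exact: uX.
  by apply: kV => j /un.
have /choice[u uP] (n : nat) : exists y, X y /\ agree n x y.
  have /clx[y []] : nbhs x [set y : fullshift A | agree n x y].
    by apply/fullshift_nbhsP; exists n.
  by exists y.
apply: (limX u) => [n|k]; first by have [] := uP n.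
apply: filterS (usually_ge k) => n /= kn j jk.
by have [_ ->//] := uP n; exact: leq_trans kn.
Qed.

Lemma subshift_ulim (A : finType) (X : subshift A) (u : nat -> X) :
  {x : X | forall k, usually [set n | agree k (val (u n)) (val x)]}.
Proof.
pose x := pointwise_ulim (fun n => val (u n)).
have Xx : x \in points X.
  rewrite inE; apply: (closed_ulim _).1 (@closed_points _ X) _ _ _ _.
    by move=> n; exact: set_mem (valP (u n)).
  exact: pointwise_ulimP.
by exists (exist _ x Xx); exact: pointwise_ulimP.
Qed.

(** An abstract form of sequential compactness, for a type whose points are
    inspected through equivalence relations [R e], one for each site [e]:
    usually two points are related by [R e] when they carry the same letter
    there. *)
Definition ulim_compact (T E : Type) (R : E -> T -> T -> Prop) : Prop :=
  forall u : nat -> T, exists x, forall e, usually [set n | R e (u n) x].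

(** If the letters at the sites of the union of an increasing family determine
    the letter at [e0], then so do those of one member: otherwise each member
    has a pair of counterexamples, and the limits of these pairs refute the
    hypothesis. *)
Lemma finite_window (T E : Type) (R : E -> T -> T -> Prop)
    (F : nat -> E -> Prop) (e0 : E) :
  (forall e x y, R e x y -> R e y x) ->
  (forall e x y z, R e x y -> R e y z -> R e x z) ->
  ulim_compact R ->
  (forall m n e, (m <= n)%N -> F m e -> F n e) ->
  (forall x y, (forall n e, F n e -> R e x y) -> R e0 x y) ->
  exists n, forall x y, (forall e, F n e -> R e x y) -> R e0 x y.
Proof.
move=> Rsym Rtrans Tc Fmono FR; apply: contrapT => nR.
have /choice[w wP] (n : nat) : exists xy : T * T,
    (forall e, F n e -> R e xy.1 xy.2) /\ ~ R e0 xy.1 xy.2.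
  apply: contrapT => nxy; apply: nR; exists n => x y xy; apply: contrapT => nR0.
  by apply: nxy; exists (x, y).
have [x ux] := Tc (fst \o w); have [y vy] := Tc (snd \o w).
have Rxy : R e0 x y.
  apply: FR => m e Fe.
  have [n [uxe vye mn]] := usually_ex3 (ux e) (vy e) (usually_ge m).
  apply: Rtrans (Rsym _ _ _ uxe) (Rtrans _ _ _ _ _ vye).
  by have [+ _] := wP n; apply; apply: Fmono Fe.
have [n [uxe vye]] := usually_ex2 (ux e0) (vy e0).
have [_] := wP n; apply.
exact: Rtrans uxe (Rtrans _ _ _ _ Rxy (Rsym _ _ _ vye)).
Qed.

(** * Sliding block codes *)

(** Commutation with the shift makes the dependence on a finite window at
    coordinate 0 uniform over all coordinates. *)
Record block_code (A C : finType) (X : subshift A) (f : X -> fullshift C) :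
    Prop := BlockCode {
  block_code1 : forall x, f (shift_on 1 x) = shift 1 (f x);
  block_code_local : exists k, forall x y : X,
    agree k (val x) (val y) -> f x 0 = f y 0 }.

Section ShiftOn.
Variables (A : finType) (X : subshift A).
Implicit Type x : X.

Lemma shift_onD (i j : int) x : shift_on i (shift_on j x) = shift_on (i + j) x.
Proof. by apply: val_inj; rewrite /= shiftD. Qed.

Lemma shift_on0 x : shift_on 0 x = x.
Proof. by apply: val_inj; rewrite /= shift0. Qed.

Lemma val_shift_on (i j : int) x : val (shift_on i x) j = val x (j + i).
Proof. by []. Qed.

Lemma shift_on_inj (i : int) : injective (@shift_on A X i).
Proof.
by move=> x y /(congr1 (shift_on (- i))); rewrite !shift_onD addNr !shift_on0.
Qed.

End ShiftOn.

Section BlockCode.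
Variables (A C : finType) (X : subshift A).
Implicit Type f : X -> fullshift C.

Lemma block_code_shift f : block_code f ->
  forall j x, f (shift_on j x) = shift j (f x).
Proof.
move=> bf; elim/int_ind => [|n IH|n IH] x.
- by rewrite shift_on0 shift0.
- by rewrite -add1n PoszD -shift_onD (block_code1 bf) IH shiftD.
- rewrite -{2}(shift_on0 x) -(subrr 1) -shift_onD (block_code1 bf) shiftD.
  rewrite (_ : - _ + 1 = - n%:Z); last by lia.
  by rewrite -IH shift_onD; congr (f (shift_on _ x)); lia.
Qed.

Lemma block_code_at f : block_code f -> forall j x, f x j = f (shift_on j x) 0.
Proof. by move=> bf j x; rewrite (block_code_shift bf) /shift add0r. Qed.

Lemma block_code_window f : block_code f -> exists k, forall (x y : X) j,
  agree k (shift j (val x)) (shift j (val y)) -> f x j = f y j.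
Proof.
move=> bf; have [k kf] := block_code_local bf; exists k => x y j xy.
by rewrite !(block_code_at bf j); exact: kf.
Qed.

Lemma block_code_agree f : block_code f -> exists k, forall l (x y : X),
  agree (k + l) (val x) (val y) -> agree l (f x) (f y).
Proof.
move=> bf; have [k kf] := block_code_window bf; exists k => l x y xy j jl.
by apply: kf; apply: agree_shift xy; lia.
Qed.

Lemma block_code_closed_image f : block_code f -> closed (range f).
Proof.
move=> bf; apply/closed_ulim => u y ufX uy.
have /choice[v vP] n : exists x, f x = u n by have [x _ <-] := ufX n; exists x.
have [x vx] := subshift_ulim v; exists x => //; apply/funext => j.
have [k kf] := block_code_agree bf.
have [n [nx ny]] := usually_ex2 (vx (k + `|j|)%N) (uy `|j|%N).
by rewrite -(ny j)// -(vP n); apply/esym/(kf _ _ _ nx).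
Qed.

Lemma block_code_shift_image f : block_code f -> shift 1 @` range f = range f.
Proof.
move=> bf; apply/seteqP; split=> [_ [_ [x _ <-] <-]|_ [x _ <-]].
  by exists (shift_on 1 x); rewrite // (block_code1 bf).
exists (f (shift_on (-1) x)); first by exists (shift_on (-1) x).
by rewrite -(block_code1 bf) shift_onD subrr shift_on0.
Qed.

Definition image_subshift f (bf : block_code f) : subshift C :=
  Subshift (block_code_closed_image bf) (block_code_shift_image bf).

(** Sites of two kinds are inspected here: the letters of the image, and the
    letter at 0 of the point, which they determine by injectivity. *)
Lemma block_code_inj_window f : block_code f -> injective f ->
  exists k, forall x y : X, agree k (f x) (f y) -> val x 0 = val y 0.
Proof.
move=> bf finj.
pose R (e : option int) (x y : X) :=
  if e is Some j then f x j = f y j else val x 0 = val y 0.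
pose F n (e : option int) := if e is Some j then (`|j| <= n)%N : Prop else False.
have [||||x y|n nP] := @finite_window X (option int) R F None.
- by case=> [j|] x y /=.
- by case=> [j|] x y z /= ->.
- move=> u; have [x ux] := subshift_ulim u; exists x => -[j|] /=.
    have [k kf] := block_code_agree bf.
    by apply: filterS (ux (k + `|j|)%N) => n /kf; exact.
  by apply: filterS (ux 0%N) => n; exact.
- by move=> m n [j|]//= mn jm; exact: leq_trans mn.
- move=> xy; suff -> : x = y by [].
  by apply: finj; apply/funext => j; exact: (xy `|j|%N (Some j) (leqnn _)).
by exists n => x y xy; apply: nP => -[j|]//= jn; exact: xy.
Qed.

End BlockCode.

Section BlockMap.
Variables (A B : finType) (X : subshift A) (Y : subshift B).
Implicit Type theta : X -> Y.

Lemma block_code_comp (C : finType) (f : Y -> fullshift C) theta :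
  block_code (val \o theta) -> block_code f -> block_code (f \o theta).
Proof.
move=> bt bf; split=> [x|] /=.
  rewrite (_ : theta _ = shift_on 1 (theta x)) ?(block_code1 bf)//.
  by apply: val_inj; exact: (block_code1 bt).
have [k kt] := block_code_agree bt; have [l lf] := block_code_local bf.
by exists (k + l)%N => x y xy; apply: lf; exact: kt.
Qed.

Lemma block_code_commute theta : block_code (val \o theta) ->
  forall j x, theta (shift_on j x) = shift_on j (theta x).
Proof. by move=> bt j x; apply: val_inj; exact: (block_code_shift bt). Qed.

(** The theorem of Curtis, Hedlund and Lyndon. The letter at 0 of the image is
    treated as one more site of the point, which passes to limits by
    continuity. *)
Lemma continuous_block_codeP theta :
  continuous theta /\ (forall x, theta (shift_on 1 x) = shift_on 1 (theta x)) <->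
  block_code (val \o theta).
Proof.
split=> [[tc ts]|bt]; last first.
  split; last exact: block_code_commute.
  move=> x V /subshift_nbhsP[l lV]; apply/subshift_nbhsP.
  have [k kt] := block_code_agree bt.
  by exists (k + l)%N => y xy; apply: lV; exact: kt.
split=> [x|]; first by rewrite /= ts.
pose R (e : option int) (x y : X) :=
  if e is Some j then val x j = val y j else val (theta x) 0 = val (theta y) 0.
pose F n (e : option int) := if e is Some j then (`|j| <= n)%N : Prop else False.
have [||||x y|n nP] := @finite_window X (option int) R F None.
- by case=> [j|] x y /=.
- by case=> [j|] x y z /= ->.
- move=> u; have [x ux] := subshift_ulim u; exists x => -[j|] /=.
    by apply: filterS (ux `|j|%N) => n; exact.
  have /tc/subshift_nbhsP[k kP] :
      nbhs (theta x) [set y : Y | val y 0 = val (theta x) 0].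
    by apply/subshift_nbhsP; exists 0%N => y xy /=; rewrite (xy 0).
  by apply: filterS (ux k) => n nx; apply: kP => j /nx.
- by move=> m n [j|]//= mn jm; exact: leq_trans mn.
- move=> xy; suff -> : x = y by [].
  by apply/val_inj/funext => j; exact: (xy `|j|%N (Some j) (leqnn _)).
by exists n => x y xy; apply: nP => -[j|]//= jn; exact: xy.
Qed.

End BlockMap.

Lemma endomorphismP (A : finType) (X : subshift A) (phi : X -> X) :
  endomorphism phi <-> block_code (val \o phi).
Proof. exact: continuous_block_codeP. Qed.

Lemma block_code_inverse (A B : finType) (X : subshift A) (Y : subshift B)
    (theta : X -> Y) (eta : Y -> X) :
  block_code (val \o theta) -> cancel theta eta -> cancel eta theta ->
  block_code (val \o eta).
Proof.
move=> bt te et; split=> [y|].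
  by rewrite /= -{1}(et y) -(block_code_commute bt) te.
have tinj : injective (val \o theta).
  by move=> x y /= /val_inj /(can_inj te).
have [k kt] := block_code_inj_window bt tinj.
by exists k => x y xy; apply: kt; rewrite /= !et.
Qed.

Lemma conjugacyP (A B : finType) (X : subshift A) (Y : subshift B)
    (theta : X -> Y) :
  conjugacy theta <-> block_code (val \o theta) /\ bijective theta.
Proof.
split=> [[[tc [eta [ec te et]]] ts]|[bt [eta te et]]].
  by split; [exact/continuous_block_codeP|exists eta].
have /continuous_block_codeP[tc ts] := bt.
have /continuous_block_codeP[ec _] := block_code_inverse bt te et.
by split=> //; split=> //; exists eta.
Qed.

Lemma conjugate_endomorphism (A B : finType) (X : subshift A) (Y : subshift B)
    (theta : X -> Y) (phi : X -> X) :
  block_code (val \o theta) -> bijective theta ->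
  endomorphism phi -> onto phi ->
  exists psi : Y -> Y,
    [/\ endomorphism psi, onto psi & forall x, theta (phi x) = psi (theta x)].
Proof.
move=> bt [eta te et] /endomorphismP bphi phi_onto.
exists (theta \o phi \o eta); split=> [|y|x] /=; last by rewrite te.
- apply/endomorphismP.
  apply: (@block_code_comp _ _ _ _ _ (val \o (theta \o phi))).
    exact: block_code_inverse bt te et.
  exact: (@block_code_comp _ _ _ _ _ (val \o theta)).
- by have [x xy] := phi_onto (eta y); exists (theta x); rewrite te xy et.
Qed.

(** * Orbits and expansiveness *)

Section Orbits.
Variables (A : finType) (X : subshift A) (phi : X -> X).
Hypothesis bphi : block_code (val \o phi).

Lemma orbit_shift (i j : int) (x : int -> X) :
  orbit_of phi x -> orbit_of phi (fun l => shift_on j (x (l + i))).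
Proof.
by move=> ox l; rewrite (block_code_commute bphi) ox addrAC.
Qed.

Lemma orbit_iter (x : int -> X) (i : int) (n : nat) :
  orbit_of phi x -> x (i + n%:Z) = iter n phi (x i).
Proof.
move=> ox; elim: n => [|n IH]; first by rewrite addr0.
by rewrite -addn1 PoszD addrA -ox IH addn1.
Qed.

Lemma orbit_through (x : X) : onto phi -> exists2 o, orbit_of phi o & o 0 = x.
Proof.
move=> /choice[g gP].
pose o (i : int) := if i is Posz n then iter n phi x
                    else iter `|i|%N g x.
exists o => // -[n|n]; first by rewrite /o -PoszD addn1.
have -> : Negz n + 1 = - n%:Z by lia.
have -> : o (- n%:Z) = iter n g x by case: n => [|n] //=.
by rewrite /o /= gP.
Qed.

(** The symbolic counterpart of expansiveness on I x J. *)
Definition determining (I J : set int) : Prop :=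
  forall x y : int -> X, orbit_of phi x -> orbit_of phi y ->
    (forall i j, I i -> J j -> val (x i) j = val (y i) j) -> x = y.

(** Orbits form a compact space because a limit of orbits, taken row by row, is
    an orbit: phi is a block code. *)
Lemma determining_window (I J : set int) (a b : int) : determining I J ->
  exists n : nat, forall x y : int -> X, orbit_of phi x -> orbit_of phi y ->
    (forall i j, I i -> J j -> (`|i| <= n)%N -> (`|j| <= n)%N ->
       val (x i) j = val (y i) j) ->
    val (x a) b = val (y a) b.
Proof.
move=> dIJ; pose T := {x : int -> X | orbit_of phi x}.
pose R (e : int * int) (x y : T) :=
  val (projT1 x e.1) e.2 = val (projT1 y e.1) e.2.
pose F n (e : int * int) : Prop :=
  [/\ I e.1, J e.2, (`|e.1| <= n)%N & (`|e.2| <= n)%N].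
have [||||x y|n nP] := @finite_window T (int * int)%type R F (a, b).
- by move=> e x y /=.
- by move=> e x y z; rewrite /R => ->.
- move=> u; pose x i := projT1 (subshift_ulim (fun n => projT1 (u n) i)).
  have ux i k : usually [set n | agree k (val (projT1 (u n) i)) (val (x i))].
    by rewrite /x; case: subshift_ulim => z /=.
  suff ox : orbit_of phi x.
    by exists (exist _ x ox) => e; apply: filterS (ux e.1 `|e.2|%N) => n; exact.
  move=> i; apply/val_inj/funext => j; have [k kP] := block_code_agree bphi.
  have [n [nx ny]] := usually_ex2 (ux i (k + `|j|)%N) (ux (i + 1) `|j|%N).
  have /= <- // := kP `|j|%N _ _ nx j.
  by rewrite (projT2 (u n)); exact: ny.
- move=> m n e mn [Ie Je em en]; split=> //; [exact: leq_trans em mn|].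
  exact: leq_trans en mn.
- move=> xy; rewrite /R; suff -> : projT1 x = projT1 y by [].
  apply: dIJ; [exact: projT2|exact: projT2|move=> i j Ii Jj].
  apply: (xy (maxn `|i| `|j|) (i, j)).
  by split; rewrite //= ?leq_maxl ?leq_maxr.
exists n => x y ox oy xy; apply: (nP (exist _ x ox) (exist _ y oy)) => -[i j].
by case=> /=; exact: xy.
Qed.

End Orbits.

(** For such a set of columns, enlarging each column to a window of fixed
    radius can be undone by a translation. This is why the choice of the
    metric, of delta, and of the coding of X does not affect expansiveness. *)
Definition shift_absorbing (J : set int) : Prop :=
  forall k : nat, exists s : int,
    forall j l, J j -> (`|l| <= k)%N -> J (j + l + s).

Lemma nonneg_absorbing : shift_absorbing [set j | 0 <= j].
Proof. by move=> k; exists k%:Z => j l /= *; lia. Qed.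

Lemma nonpos_absorbing : shift_absorbing [set j | j <= 0].
Proof. by move=> k; exists (- k%:Z) => j l /= *; lia. Qed.

Lemma determining_conj (A B : finType) (X : subshift A) (Y : subshift B)
    (phi : X -> X) (psi : Y -> Y) (theta : X -> Y) (I J : set int) :
  block_code (val \o phi) -> shift_absorbing J ->
  block_code (val \o theta) -> injective theta ->
  (forall x, theta (phi x) = psi (theta x)) ->
  determining psi I J -> determining phi I J.
Proof.
move=> bphi absJ bt tinj tphi dpsi x y ox oy xy.
have [k kt] := block_code_window bt; have [s sJ] := absJ k.
pose x' i := theta (shift_on s (x i)); pose y' i := theta (shift_on s (y i)).
have x'y' : x' = y'.
  apply: dpsi => [i|i|i j Ii Jj].
  - by rewrite -tphi (block_code_commute bphi) ox.
  - by rewrite -tphi (block_code_commute bphi) oy.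
  - apply: kt => l lk; rewrite /shift /= /shift; apply: xy => //.
    by rewrite (addrC l); exact: sJ.
apply/funext => i; apply: (@shift_on_inj _ _ s).
exact/tinj/(congr1 (@^~ i) x'y').
Qed.

Section Metric.
Variables (R : realType) (A : finType) (X : subshift A) (d : X -> X -> R).
Hypothesis hd : compatible_metric d.

Lemma ball_agree (x : X) (e : R) : 0 < e ->
  exists k, forall y : X, agree k (val x) (val y) -> d x y < e.
Proof.
move=> e0; apply/(subshift_nbhsP x [set y | d x y < e]).
by apply/(dist_nbhs hd); exists e.
Qed.

(** Uniform continuity of the distance at the diagonal: the limit of a sequence
    of bad pairs would be a single point close to both terms of some pair. *)
Lemma agree_close (e : R) : 0 < e ->
  exists k, forall x y : X, agree k (val x) (val y) -> d x y <= e.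
Proof.
move=> e0; apply: contrapT => ne.
have /choice[w wP] (k : nat) : exists xy : X * X,
    agree k (val xy.1) (val xy.2) /\ e < d xy.1 xy.2.
  apply: contrapT => nxy; apply: ne; exists k => x y xy; rewrite leNgt.
  by apply/negP => exy; apply: nxy; exists (x, y).
have [x wx] := subshift_ulim (fst \o w).
have e2 : 0 < e / 2 by rewrite divr_gt0.
have [k kx] := ball_agree x e2.
have [n [nx kn]] := usually_ex2 (wx k) (usually_ge k).
have [wn] := wP n; apply/negP; rewrite -leNgt.
apply: le_trans (dist_triangle hd _ x _) _.
rewrite (splitr e) ltW// ltrD//; first by rewrite (dist_sym hd) kx// => j /nx.
by apply: kx => j jk; rewrite -(nx j jk) /= wn//; exact: leq_trans kn.
Qed.

Lemma close_agree :
  exists2 e : R, 0 < e & forall x y : X, d x y <= e -> val x 0 = val y 0.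
Proof.
apply: contrapT => ne.
have /choice[w wP] (k : nat) : exists xy : X * X,
    d xy.1 xy.2 <= k.+1%:R^-1 /\ val xy.1 0 <> val xy.2 0.
  apply: contrapT => nxy; apply: ne; exists k.+1%:R^-1; first by rewrite invr_gt0.
  move=> x y dxy; apply: contrapT => xy; apply: nxy; exists (x, y).
  by split.
have [x wx] := subshift_ulim (fst \o w).
have [e e0 ex] : exists2 e : R, 0 < e &
    [set y | d x y < e] `<=` [set y : X | val y 0 = val x 0].
  apply/(dist_nbhs hd)/subshift_nbhsP; exists 0%N => y xy /=.
  by rewrite (xy 0).
have e2 : 0 < e / 2 by rewrite divr_gt0.
have [k kx] := ball_agree x e2.
have [m me] : exists m : nat, m.+1%:R^-1 < e / 2.
  exists (Num.bound (e / 2)^-1); rewrite -[ltRHS]invrK ltf_pV2 ?posrE ?invr_gt0//.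
  apply: lt_le_trans (archi_boundP _) _; first by rewrite invr_ge0 ltW.
  by rewrite ler_nat.
have [n [nx n0 mn]] := usually_ex3 (wx k) (wx 0%N) (usually_ge m).
have [dn] := wP n; apply.
have -> : val (w n).1 0 = val x 0 by exact: n0.
apply/esym/ex => /=; apply: le_lt_trans (dist_triangle hd _ (w n).1 _) _.
rewrite (splitr e) ltrD//; first by apply: kx => j /nx.
by apply: le_lt_trans me; apply: le_trans dn _; rewrite lef_pV2 ?posrE// ler_nat.
Qed.

Lemma expansive_onP (phi : X -> X) (I J : set int) :
  block_code (val \o phi) -> shift_absorbing J ->
  expansive_on I J d phi <-> determining phi I J.
Proof.
move=> bphi absJ; split=> [[e e0 ephi] x y ox oy xy|dphi].
  have [k kP] := agree_close e0; have [s sJ] := absJ k.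
  suff : (fun i => shift_on s (x (i + 0))) = (fun i => shift_on s (y (i + 0))).
    move=> sxy; apply/funext => i; have := congr1 (@^~ i) sxy.
    by rewrite /= addr0 => /shift_on_inj.
  apply: ephi => [||i j Ii Jj]; [exact: orbit_shift|exact: orbit_shift|].
  apply: kP => l lk; rewrite addr0 /= /shift; apply: xy => //.
  by rewrite (addrC l); exact: sJ.
have [e e0 eP] := close_agree; exists e => // x y ox oy xy.
apply: dphi => // i j Ii Jj; have := eP _ _ (xy i j Ii Jj).
by rewrite /= /shift add0r.
Qed.

End Metric.

(** * From resolving textile systems to expansiveness on the upper side *)

Lemma block_map_code (A B : finType) (Gamma : graph B) (G : graph A)
    (h : graph_hom Gamma G) (Z : subshift B) :
  block_code (fun z : Z => block_map h (val z)).
Proof.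
split=> [//|]; exists 0%N => x y xy.
by rewrite /block_map xy.
Qed.

(** Agreement of the lifted rows is propagated one column to the left at a
    time: [low] by expansiveness, for rows far down, and [climb] by the
    left-resolving map, from those rows up to row 0. *)
Lemma weakly_pL_upper (A : finType) (X : subshift A) (phi : X -> X) :
  endomorphism phi -> weak_endo weakly_pL phi ->
  determining phi setT [set j | 0 <= j] ->
  determining phi [set i | i <= 0] [set j | 0 <= j].
Proof.
move=> /endomorphismP bphi [B [Gamma [G [T [Z [TL ZG [pinj pZ _ qphi]]]]]]] dphi.
move=> x y ox oy xy.
have bp := block_map_code (tp T) Z.
have [k kP] : exists k, forall z w : Z,
    agree k (block_map (tp T) (val z)) (block_map (tp T) (val w)) ->
    val z 0 = val w 0.
  apply: (block_code_inj_window bp) => z w zw; apply/val_inj/pinj => //.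
    exact: valP.
  exact: valP.
have /choice[rho rhoP] (u : X) : exists z : Z, block_map (tp T) (val z) = val u.
  have [z Zz zu] : (block_map (tp T) @` Z) (val u).
    by rewrite pZ; exact: set_mem (valP u).
  by exists (exist _ z (mem_set Zz)).
have pE u j : arc_map (tp T) (val (rho u) j) = val u j by rewrite -rhoP.
have qE u j : arc_map (tq T) (val (rho u) j) = val (phi u) j.
  by rewrite (qphi (val (rho u)))//; exact: set_mem (valP (rho u)).
have pathE u j : ter Gamma (val (rho u) j) = ini Gamma (val (rho u) (j + 1)).
  by apply: ZG; exact: set_mem (valP (rho u)).
have [n nP] := determining_window bphi 0 (-1) dphi.
have column (c : int) :
    (forall i j, i <= 0 -> c < j -> val (rho (x i)) j = val (rho (y i)) j) ->
    forall i, i <= 0 -> val (rho (x i)) c = val (rho (y i)) c.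
  move=> right.
  have lift_row i : i <= 0 -> val (x i) c = val (y i) c ->
      val (rho (x i)) c = val (rho (y i)) c.
    move=> i0 xyc; apply: TL; last by rewrite !pE.
    by rewrite !pathE right//; lia.
  have low i : i <= - n%:Z -> val (x i) c = val (y i) c.
    move=> i_n; have := nP _ _ (orbit_shift bphi i (c + 1) ox)
                               (orbit_shift bphi i (c + 1) oy).
    rewrite /= /shift add0r (_ : -1 + (c + 1) = c); last by lia.
    apply=> l j _ j0 ln jn; rewrite -!pE right//; lia.
  have climb (t : nat) i : i <= 0 -> i <= - n%:Z + t%:Z ->
      val (rho (x i)) c = val (rho (y i)) c.
    elim: t i => [|t IH] i i0 it; first by apply: lift_row => //; apply: low; lia.
    apply: lift_row => //.
    rewrite -[i](subrK 1) -ox -oy -!qE IH//; lia.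
  by move=> i i0; apply: (climb n) => //; lia.
(* The constant k is the window of the inverse of phi_p: the lifts agree from
   column k on, because the letters agree from column 0 on. *)
have all_right (m : nat) i j : i <= 0 -> k%:Z - m%:Z <= j ->
    val (rho (x i)) j = val (rho (y i)) j.
  elim: m i j => [|m IH] i j i0.
    move=> kj; have := kP (shift_on j (rho (x i))) (shift_on j (rho (y i))).
    rewrite !val_shift_on !add0r; apply => l lk.
    rewrite /block_map !val_shift_on !pE; apply: xy => //=; lia.
  move=> mj; have [/IH->//|jm] := lerP (k%:Z - m%:Z) j.
  apply: column => // i' j' i'0 jj'; apply: IH => //; lia.
have x0y0 : x 0 = y 0.
  apply/val_inj/funext => j; rewrite -!pE.
  by rewrite (all_right (k + `|j|)%N)//; lia.
apply: dphi => // i j _ _; have [i0|i0] := lerP i 0.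
  by rewrite -!pE (all_right (k + `|j|)%N)//; lia.
have -> : i = 0 + `|i|%N%:Z by lia.
by rewrite !(orbit_iter _ _ ox, orbit_iter _ _ oy) x0y0.
Qed.

(** The woven rows form a subshift, because the two-dimensional textiles
    themselves are closed under limits. *)
Lemma woven_closed (A B : finType) (Gamma : graph B) (G : graph A)
    (T : textile Gamma G) : closed (woven T).
Proof.
apply/closed_ulim => u z /choice[zs zsP] uz.
pose w i := pointwise_ulim (fun n => zs n i).
exists w; split.
- move=> i j; have := pointwise_ulimP (fun n => zs n i) (`|j| + 1)%N.
  move=> /filter_ex[n /= nw]; have [/(_ i j) + _ _] := zsP n.
  by rewrite !nw; [|lia|lia].
- apply/funext => j.
  have [n [nw nz]] :=
    usually_ex2 (pointwise_ulimP (fun n => zs n 0) `|j|%N) (uz `|j|%N).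
  by rewrite -[RHS]nz// /w -nw//; have [_ -> _] := zsP n.
- move=> i; apply/funext => j.
  have [n [nw nw']] := usually_ex2
    (pointwise_ulimP (fun n => zs n (i - 1)) `|j|%N)
    (pointwise_ulimP (fun n => zs n i) `|j|%N).
  have [_ _ /(_ i)/(congr1 (@^~ j))] := zsP n.
  by rewrite /= /block_map nw// nw'.
Qed.

Lemma woven_shift (A B : finType) (Gamma : graph B) (G : graph A)
    (T : textile Gamma G) : shift 1 @` woven T = woven T.
Proof.
have shift_woven j z : woven T z -> woven T (shift j z).
  move=> [zs [zsP <- zsq]]; exists (fun i => shift j (zs i)); split=> //.
    by move=> i l; rewrite /shift addrAC; exact: zsP.
  move=> i; apply/funext => l.
  exact: (congr1 (fun f : fullshift A => f (l + j)) (zsq i)).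
apply/seteqP; split=> [_ [z wz <-]|z wz]; first exact: shift_woven.
by exists (shift (-1) z); [exact: shift_woven|rewrite shiftD subrr shift0].
Qed.

Lemma left_resolving_weakly (A B : finType) (Gamma : graph B) (G : graph A)
    (h : graph_hom Gamma G) : left_resolving h -> weakly_left_resolving h.
Proof.
move=> hL b c tbc hbc.
have [d [_ dP]] := hL (ter Gamma b) (arc_map h b) (ter_map h b).
by rewrite -(dP b)// -(dP c)//; split; rewrite ?hbc ?tbc.
Qed.

Lemma strong_weak_pL (A : finType) (G : graph A)
    (phi : path_shift G -> path_shift G) :
  strong_endo pL phi -> weak_endo weakly_pL phi.
Proof.
move=> [B [Gamma [T [TL repr]]]].
exists B, Gamma, G, T,
  (Subshift (@woven_closed _ _ _ _ T) (@woven_shift _ _ _ _ T)).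
by split=> //; [exact: left_resolving_weakly|move=> z [zs [zsP <- _]]].
Qed.

(** Being determined by a region is invariant under conjugacy, so it may be
    carried over to the resolving model and back. *)
Lemma conj_weakly_pL_upper (A A' : finType) (X : subshift A) (X' : subshift A')
    (phi : X -> X) (phi' : X' -> X') (theta : X -> X') :
  endomorphism phi -> endomorphism phi' -> conjugacy theta ->
  (forall x, theta (phi x) = phi' (theta x)) -> weak_endo weakly_pL phi' ->
  determining phi setT [set j | 0 <= j] ->
  determining phi [set i | i <= 0] [set j | 0 <= j].
Proof.
move=> /endomorphismP bphi ephi' /conjugacyP[bt [eta te et]] tphi pL' dphi.
have bphi' := (endomorphismP _).1 ephi'.
apply: (determining_conj bphi nonneg_absorbing bt (can_inj te) tphi).
apply: weakly_pL_upper => //.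
apply: (determining_conj bphi' nonneg_absorbing _ (can_inj et) _ dphi).
  exact: block_code_inverse bt te et.
by move=> y; rewrite -{1}(et y) -tphi te.
Qed.

(** * Rauzy graphs and one-sided endomorphisms *)

Section Words.
Variables (A : finType) (X : subshift A).
Implicit Types (x y : X) (m k : nat).

Definition word m (x : fullshift A) : {ffun 'I_m -> A} :=
  [ffun k : 'I_m => x (k : nat)%:Z].

Definition lang m : finType :=
  {w : {ffun 'I_m -> A} | `[< exists x : X, word m (val x) = w >]}.

Lemma word_lang m x : `[< exists y : X, word m (val y) = word m (val x) >].
Proof. by apply/asboolP; exists x. Qed.

Definition lword m x : lang m := exist _ (word m (val x)) (word_lang m x).

Lemma lwordP m x y :
  lword m x = lword m y <-> forall k, (k < m)%N -> val x k = val y k.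
Proof.
split=> [/(congr1 val)/= /ffunP xy k km|xy].
  by have := xy (Ordinal km); rewrite !ffunE.
by apply/val_inj/ffunP => k /=; rewrite !ffunE; exact: xy.
Qed.

Lemma lang_rep m (w : lang m) : {x : X | lword m x = w}.
Proof.
apply: cid; have /asboolP[x xw] := valP w; exists x; exact: val_inj.
Qed.

(** Working with a point of X in which a word occurs spares all manipulation of
    prefixes and suffixes of words as finite functions. *)
Definition rep m (w : lang m) : X := projT1 (lang_rep w).

Lemma repK m (w : lang m) : lword m (rep w) = w.
Proof. exact: projT2 (lang_rep w). Qed.

Lemma rep_lword m x k : (k < m)%N -> val (rep (lword m x)) k = val x k.
Proof. by move: k; apply/lwordP; rewrite repK. Qed.

(** The Rauzy graph of X: an arc is a word of length m + 1 occurring in X, and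
    leads from its prefix to its suffix of length m. *)
Definition rauzy m : graph (lang m.+1) :=
  @Graph _ (lang m) (fun w => lword m (rep w))
                    (fun w => lword m (shift_on 1 (rep w))).

Lemma ini_lword m x : ini (rauzy m) (lword m.+1 x) = lword m x.
Proof. by apply/lwordP => k km; rewrite rep_lword// ltnW. Qed.

Lemma ter_lword m x : ter (rauzy m) (lword m.+1 x) = lword m (shift_on 1 x).
Proof.
apply/lwordP => k km; rewrite !val_shift_on (_ : k%:Z + 1 = k.+1%:Z); last by lia.
exact: rep_lword.
Qed.

Lemma rep_ini m (b : lang m.+1) k : (k < m)%N ->
  val (rep (ini (rauzy m) b)) k = val (rep b) k.
Proof. exact: rep_lword. Qed.

Lemma rep_ter m (b : lang m.+1) k : (k < m)%N ->
  val (rep (ter (rauzy m) b)) k = val (rep b) (k%:Z + 1).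
Proof. exact: rep_lword. Qed.

(** The terminal vertex lacks only the first letter of the arc. *)
Lemma rauzy_left_determined m (b c : lang m.+1) :
  ter (rauzy m) b = ter (rauzy m) c -> val (rep b) 0 = val (rep c) 0 -> b = c.
Proof.
rewrite -[b]repK -[c]repK !ter_lword => /lwordP bc; rewrite !rep_lword// => bc0.
apply/lwordP => -[//|k] km; have := bc k km; rewrite !val_shift_on.
by rewrite (_ : k%:Z + 1 = k.+1%:Z)//; lia.
Qed.

Lemma rauzy_nondegenerate m : Defs.nondegenerate (rauzy m).
Proof.
split=> v.
  by exists (lword m.+1 (rep v)); rewrite ini_lword repK.
exists (lword m.+1 (shift_on (-1) (rep v))).
by rewrite ter_lword shift_onD subrr shift_on0 repK.
Qed.

Definition code m x : fullshift (lang m.+1) := fun j => lword m.+1 (shift_on j x).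

Lemma code_paths m x : paths (rauzy m) (code m x).
Proof. by move=> j; rewrite /code ter_lword ini_lword shift_onD addrC. Qed.

Lemma block_code_code m : block_code (code m).
Proof.
split=> [x|]; first by apply/funext => j; rewrite /shift /code shift_onD.
exists m => x y xy; apply/lwordP => k km.
by rewrite !val_shift_on xy//; lia.
Qed.

Lemma rep_code m x j : val (rep (code m x j)) 0 = val x j.
Proof. by rewrite rep_lword// val_shift_on add0r. Qed.

Lemma code_inj m : injective (code m).
Proof.
move=> x y xy; apply/val_inj/funext => j.
by rewrite -(rep_code m x) xy rep_code.
Qed.

(** Consecutive arcs of a path overlap in all letters but one, so the letter at
    place k of an arc is the first letter of the arc k steps later. *)
Lemma path_rep m (z : fullshift (lang m.+1)) (j : int) k :
  paths (rauzy m) z -> (k <= m)%N ->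
  val (rep (z j)) k%:Z = val (rep (z (j + k%:Z))) 0.
Proof.
move=> zP; elim: k j => [|k IH] j km; first by rewrite addr0.
rewrite (_ : j + _ = j + 1 + k%:Z); last by lia.
rewrite -IH; last by lia.
have := zP j; rewrite -[z j]repK -[z (j + 1)]repK ter_lword ini_lword.
move=> /lwordP/(_ k km); rewrite !repK val_shift_on => <-.
by congr (val _ _); lia.
Qed.

Lemma path_code m (z : fullshift (lang m.+1)) x : paths (rauzy m) z ->
  (forall j, val x j = val (rep (z j)) 0) -> code m x = z.
Proof.
move=> zP xz; apply/funext => j; rewrite -[RHS]repK; apply/lwordP => k km.
by rewrite val_shift_on xz path_rep// addrC.
Qed.

End Words.

Definition one_sided (A : finType) (X : subshift A) (phi : X -> X) : Prop :=
  exists m : nat, forall x y : X,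
    (forall k : nat, (k <= m)%N -> val x k = val y k) ->
    val (phi x) 0 = val (phi y) 0.

Definition bouquet (A : finType) : graph A :=
  @Graph A unit (fun=> tt) (fun=> tt).

Definition bouquet_hom (A B : finType) (Gamma : graph B) (f : B -> A) :
  graph_hom Gamma (bouquet A).
Proof. by exists f (fun=> tt). Defined.

Lemma one_sided_weakly_pL (A : finType) (X : subshift A) (phi : X -> X) :
  endomorphism phi -> one_sided phi -> weak_endo weakly_pL phi.
Proof.
move=> /endomorphismP bphi [m mP].
pose T := @Textile _ _ (rauzy X m) (bouquet A)
  (bouquet_hom _ (fun w => val (rep w) 0))
  (bouquet_hom _ (fun w => val (phi (rep w)) 0)).
have pcode x : block_map (tp T) (code m x) = val x.
  by apply/funext => j; exact: rep_code.
have qcode x : block_map (tq T) (code m x) = val (phi x).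
  apply/funext => j; rewrite -[RHS]/((val \o phi) x j) (block_code_at bphi).
  by apply: mP => k km; rewrite rep_lword.
exists _, _, _, T, (image_subshift (block_code_code X m)); split.
- by move=> b c; exact: rauzy_left_determined.
- by move=> _ [x _ <-]; exact: code_paths.
- split.
  + move=> z w; rewrite !inE => -[x _ <-] [y _ <-].
    by rewrite !pcode => /val_inj ->.
  + apply/seteqP; split=> [_ [_ [x _ <-] <-]|x Xx].
      by rewrite pcode; exact: set_mem (valP x).
    exists (code m (exist _ x (mem_set Xx))); last by rewrite pcode.
    by exists (exist _ x (mem_set Xx)).
  + by move=> _ [_ [x _ <-] <-]; rewrite qcode; exact: set_mem (valP (phi x)).
  + by move=> _ x [y _ <-]; rewrite pcode => /val_inj <-; rewrite qcode.
Qed.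

(** The stack of x, phi x, .., phi^n x is a conjugate copy of x, because its
    bottom row is x. Its image under phi is the same stack moved up by one row: the
    first n of its rows are visible in the stack, and the window of the
    quadrant gives the last one from letters at columns to the right. *)
Lemma upper_one_sided (A : finType) (X : subshift A) (phi : X -> X) :
  (1 < #|A|)%N -> endomorphism phi -> onto phi ->
  determining phi [set i | i <= 0] [set j | 0 <= j] ->
  exists (A' : finType) (X' : subshift A') (psi : X' -> X') (theta : X -> X'),
    [/\ (1 < #|A'|)%N, endomorphism psi /\ onto psi, one_sided psi,
        conjugacy theta & forall x, theta (phi x) = psi (theta x)].
Proof.
move=> hA ephi phi_onto dphi; have bphi := (endomorphismP _).1 ephi.
have [n nP] := determining_window bphi 1 0 dphi.
have biter i : block_code (fun x : X => val (iter i phi x)).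
  elim: i => [|i IH]; first by split=> //; exists 0%N => x y; exact.
  exact: (block_code_comp (f := fun x : X => val (phi x)) (theta := iter i phi)).
pose stack (x : X) : fullshift {ffun 'I_n.+1 -> A} :=
  fun j => [ffun i : 'I_n.+1 => val (iter i phi x) j].
have bstack : block_code stack.
  split=> [x|].
    by apply/funext => j; apply/ffunP => i; rewrite !ffunE (block_code1 (biter i)).
  have /choice[k kP] (i : 'I_n.+1) := block_code_local (biter i).
  exists (\max_i k i) => x y xy; apply/ffunP => i; rewrite !ffunE.
  by apply: kP; apply: agree_leq _ xy; exact: leq_bigmax.
have stackE x j (i : 'I_n.+1) : stack x j i = val (iter i phi x) j.
  by rewrite ffunE.
have stack_inj : injective stack.
  move=> x y xy; apply/val_inj/funext => j.
  by have := stackE x j ord0; rewrite xy stackE.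
pose X' := image_subshift bstack.
have Xstack x : stack x \in points X' by rewrite inE; exists x.
pose theta (x : X) : X' := exist _ (stack x) (Xstack x).
have bt : block_code (val \o theta) by [].
have /choice[eta etaP] (y : X') : exists x, theta x = y.
  have [x _ xy] := set_mem (valP y).
  by exists x; exact: val_inj.
have tbij : bijective theta.
  exists eta => [x|y]; last exact: etaP.
  by apply: stack_inj; have /(congr1 val) := etaP (theta x).
have [psi [epsi psi_onto tpsi]] := conjugate_endomorphism bt tbij ephi phi_onto.
exists {ffun 'I_n.+1 -> A}, X', psi, theta; split=> //.
- rewrite card_ffun card_ord (leq_trans hA)//.
  by rewrite -{1}[#|A|]expn1 leq_pexp2l// ltnW.
- exists n => y y'; rewrite -(etaP y) -(etaP y') -!tpsi.
  set x := eta y; set x' := eta y' => xx'.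
  have xx'_low i j : (i <= n)%N -> (j <= n)%N ->
      val (iter i phi x) j%:Z = val (iter i phi x') j%:Z.
    move=> i_n jn; have := congr1 (fun f : {ffun _ -> _} => f (inord i)) (xx' j jn).
    by rewrite /= !stackE inordK.
  apply/ffunP => i; rewrite !stackE -!iterSr.
  have [i_n|] := ltnP i n; first exact: (xx'_low i.+1 0%N).
  have := ltn_ord i; rewrite ltnS => le_in ge_in.
  have {le_in ge_in} -> : (i : nat) = n by apply/eqP; rewrite eqn_leq le_in.
  (* Only the top row of the image is left; x is put in row - n of an orbit. *)
  have [o oo o0] := orbit_through x phi_onto.
  have [o' oo' o'0] := orbit_through x' phi_onto.
  have := nP _ _ (orbit_shift bphi n 0 oo) (orbit_shift bphi n 0 oo').
  rewrite !shift_on0 (_ : 1 + n%:Z = 0 + n.+1%:Z); last by lia.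
  rewrite !(orbit_iter _ _ oo, orbit_iter _ _ oo') o0 o'0; apply.
  move=> l j l0 j0 ln jn.
  have -> : l + n%:Z = 0 + (n - `|l|)%N%:Z by move: l0 ln => /=; lia.
  rewrite !shift_on0 !(orbit_iter _ _ oo, orbit_iter _ _ oo') o0 o'0.
  have -> : j = `|j|%N%:Z by move: j0 => /=; lia.
  by apply: xx'_low => //; exact: leq_subr.
- exact/conjugacyP.
Qed.

(** * One-sided endomorphisms of shifts of finite type *)

Definition finite_type (A : finType) (X : subshift A) (m : nat) : Prop :=
  forall y : fullshift A,
    (forall j, exists x : X, forall k : nat, (k <= m)%N ->
       val x k = y (j + k%:Z)) ->
    points X y.

(** Let all long words of y occur in X. Applying theta to y window by window
    gives a sequence g of arcs of G, which is a path because two consecutive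
    arcs are read off one word of X; the point of X with image g is y, by the
    same local comparison for the inverse of theta. The width of the words must
    cover both windows, and one more letter for the consecutive arcs. *)
Lemma conj_finite_type (A B : finType) (X : subshift A) (G : graph B)
    (theta : X -> path_shift G) :
  block_code (val \o theta) -> bijective theta -> exists m, finite_type X m.
Proof.
move=> bt [eta te et].
have [k kP] := block_code_window bt.
have [l lP] := block_code_window (block_code_inverse bt te et).
exists (2 * (k + l) + 1)%N => y yX.
(* w j is a point of X that coincides with y near j, moved to the origin. *)
have /choice[w wP] (j : int) : exists x : X, forall i : int,
    - (k + l)%:Z <= i <= (k + l + 1)%:Z -> val x i = y (j + i).
  have [x xP] := yX (j - (k + l)%:Z); exists (shift_on (k + l)%:Z x) => i ikl.
  have ikl_nat : i + (k + l)%:Z = (absz (i + (k + l)%:Z))%:Z by lia.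
  rewrite val_shift_on ikl_nat.
  by rewrite xP; [congr y; lia|lia].
pose g : fullshift B := fun j => val (theta (w j)) 0.
have gE (i j : int) : - l%:Z <= i <= l%:Z + 1 -> g (j + i) = val (theta (w j)) i.
  move=> il; rewrite -[RHS]/((val \o theta) (w j) i) (block_code_at bt) /g.
  by apply: kP => s sk; rewrite !shift0 /= /shift !wP; [congr y|..]; lia.
have Gg : g \in paths G.
  rewrite inE => j; rewrite -{1}[j]addr0 !gE; [|lia|lia].
  by have := set_mem (valP (theta (w j))) 0; rewrite add0r.
pose x := eta (exist _ g Gg).
suff -> : y = val x by exact: set_mem (valP x).
apply/funext => j; have := wP j 0; rewrite addr0 => <-; last by lia.
rewrite -[in LHS](te (w j)) -[j in RHS]add0r -[RHS]/(val (shift_on j x) 0).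
rewrite /x -(block_code_commute (block_code_inverse bt te et)).
by apply: lP => i il; rewrite !shift0 /= /shift (addrC i) gE//; lia.
Qed.

Lemma finite_type_code (A : finType) (X : subshift A) (m : nat) :
  finite_type X m ->
  exists theta : X -> path_shift (rauzy X m),
    [/\ forall x, val (theta x) = code m x, block_code (val \o theta) &
        bijective theta].
Proof.
move=> Xm; pose P := path_shift (rauzy X m).
have Pcode x : code m x \in points P by rewrite inE; exact: code_paths.
pose theta x : P := exist _ (code m x) (Pcode x).
have /choice[eta etaP] (z : P) : exists x, theta x = z.
  have zP : paths (rauzy X m) (val z) by exact: set_mem (valP z).
  pose x : fullshift A := fun j => val (rep (val z j)) 0.
  have Xx : x \in points X.
    rewrite inE; apply: Xm => j; exists (rep (val z j)) => k km.
    exact: path_rep.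
  by exists (exist _ x Xx); apply/val_inj/path_code.
exists theta; split=> //; first exact: block_code_code.
exists eta => [x|z]; last exact: etaP.
by apply: (@code_inj _ _ m); have /(congr1 val) := etaP (theta x).
Qed.

(** One-sidedness survives the coding by words because words are read to the
    right. *)
Lemma one_sided_code (A : finType) (X : subshift A) (m : nat)
    (theta : X -> path_shift (rauzy X m)) (phi : X -> X)
    (psi : path_shift (rauzy X m) -> path_shift (rauzy X m)) :
  endomorphism phi ->
  (forall x, val (theta x) = code m x) -> bijective theta ->
  (forall x, theta (phi x) = psi (theta x)) ->
  one_sided phi -> one_sided psi.
Proof.
move=> /endomorphismP bphi tE [eta te et] tphi [l lP].
exists (m + l)%N => z w; rewrite -(et z) -(et w) -!tphi !tE.
set x := eta z; set y := eta w => xy.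
apply/lwordP => k km; rewrite !shift_on0.
have := block_code_at bphi k%:Z; rewrite /= => bk; rewrite !bk.
apply: lP => i il; rewrite !val_shift_on -PoszD.
by rewrite -(rep_code m x) -(rep_code m y) xy//; lia.
Qed.

Lemma glue_paths (A : finType) (G : graph A) (x y : path_shift G) :
  ini G (val x 0) = ini G (val y 0) ->
  exists z : path_shift G, forall j : int,
    val z j = if j < 0 then val x j else val y j.
Proof.
move=> xy0; pose z : fullshift A := fun j => if j < 0 then val x j else val y j.
have Gx := set_mem (valP x); have Gy := set_mem (valP y).
suff Gz : z \in points (path_shift G) by exists (exist _ z Gz).
rewrite inE => j; rewrite /z; case: ifPn => j0; case: ifPn => j1.
- exact: Gx.
- by rewrite Gx (_ : j + 1 = 0)//; lia.
- by lia.
- exact: Gy.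
Qed.

Section OneSidedMarkov.
Variables (A : finType) (G : graph A).
Let X := path_shift G.
Variable phi : X -> X.
Hypotheses (ephi : endomorphism phi) (phi_onto : onto phi).
Hypothesis occurs : forall a : A, exists x : X, val x 0 = a.
Variable m : nat.
Hypothesis phi_m : forall x y : X,
  (forall k : nat, (k <= m.+1)%N -> val x k = val y k) ->
  val (phi x) 0 = val (phi y) 0.

Let bphi : block_code (val \o phi) := (endomorphismP _).1 ephi.

Lemma path_ter (x : X) (j : int) : ter G (val x j) = ini G (val x (j + 1)).
Proof. by have := set_mem (valP x) j. Qed.

(** The arc phi(x)(0) depends on the letters at 0 .. m + 1, but its initial
    vertex is also the terminal vertex of phi(x)(-1), which depends on the
    letters at - 1 .. m. Gluing the past of x to the future of y compares the
    two. *)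
Lemma one_sided_vertex (x y : X) :
  (forall k : nat, (k <= m)%N -> val x k = val y k) ->
  ini G (val (phi x) 0) = ini G (val (phi y) 0).
Proof.
move=> xy; have [|z zP] := @glue_paths _ _ x y; first by rewrite (xy 0%N).
have -> : val (phi y) 0 = val (phi z) 0.
  by apply: phi_m => k _; rewrite zP.
have prev (u : X) : ini G (val (phi u) 0) = ter G (val (phi (shift_on (-1) u)) 0).
  by rewrite path_ter (block_code_commute bphi) val_shift_on add0r subrr.
rewrite !prev; congr ter; apply: phi_m => -[|k] km; rewrite !val_shift_on zP.
  by rewrite add0r.
by rewrite (_ : k.+1%:Z - 1 = k%:Z); [exact: xy|lia].
Qed.

(** The vertices of [rauzy X m.+1] are nonempty words, so their first letter
    has an initial vertex in G. *)
Definition first_hom : graph_hom (rauzy X m.+1) G.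
Proof.
exists (fun w => val (rep w) 0) (fun v => ini G (val (rep v) 0)).
- by move=> b; rewrite rep_ini.
- by move=> b; rewrite rep_ter// path_ter.
Defined.

Definition image_hom : graph_hom (rauzy X m.+1) G.
Proof.
exists (fun w => val (phi (rep w)) 0) (fun v => ini G (val (phi (rep v)) 0)).
- by move=> b; apply: one_sided_vertex => k km; rewrite rep_ini.
- move=> b; rewrite path_ter -[val (phi (rep b)) (0 + 1)]val_shift_on.
  rewrite -(block_code_commute bphi); apply: one_sided_vertex => k km.
  by rewrite rep_ter.
Defined.

Let T := Textile first_hom image_hom.

(** An arc a of G ending where the word v begins can be put in front of v: glue
    the past of a point showing a to a point showing v. *)
Lemma first_hom_left_resolving : left_resolving first_hom.
Proof.
move=> v a av; have {}av : ter G a = ini G (val (rep v) 0) := av.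
have [y ya] := occurs a.
have [|z zP] := @glue_paths _ _ (shift_on 1 y) (rep v).
  by rewrite val_shift_on add0r -av -ya path_ter.
set b := lword m.+2 (shift_on (-1) z).
have ba : val (rep b) 0 = a by rewrite rep_lword// val_shift_on zP.
have bv : ter (rauzy X m.+1) b = v.
  rewrite ter_lword shift_onD subrr shift_on0 -[RHS]repK.
  by apply/lwordP => k km; rewrite zP.
exists b; split=> [//|c [ca cv]].
apply: rauzy_left_determined; first by rewrite bv cv.
exact: etrans ba (esym ca).
Qed.

Lemma first_code (x : X) : block_map first_hom (code m.+1 x) = val x.
Proof. by apply/funext => j; exact: rep_code. Qed.

Lemma image_code (x : X) : block_map image_hom (code m.+1 x) = val (phi x).
Proof.
apply/funext => j; rewrite -[RHS]/((val \o phi) x j) (block_code_at bphi).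
by apply: phi_m => k km; rewrite rep_lword.
Qed.

(** Every path of the Rauzy graph is the code of a point of X, and since phi is
    onto every code is a row of a textile; so the woven rows are exactly the
    codes. *)
Lemma woven_code (z : fullshift (lang X m.+2)) :
  woven T z -> exists x : X, code m.+1 x = z.
Proof.
move=> [zs [zsP <- _]].
have Xx : block_map first_hom (zs 0) \in points X.
  by rewrite inE => j; rewrite /block_map ter_map ini_map zsP.
pose x : X := exist _ (block_map first_hom (zs 0)) Xx.
by exists x; apply: path_code.
Qed.

Lemma code_woven (x : X) : woven T (code m.+1 x).
Proof.
have [o oo o0] := orbit_through x phi_onto.
exists (fun i => code m.+1 (o i)); split.
- by move=> i; exact: code_paths.
- by rewrite o0.
- by move=> i; rewrite image_code first_code oo subrK.
Qed.

Lemma one_sided_pL : strong_endo pL phi.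
Proof.
exists _, _, T; split; first exact: first_hom_left_resolving.
split.
- move=> z w; rewrite !inE => /woven_code[x <-] /woven_code[y <-].
  by rewrite !first_code => /val_inj ->.
- apply/seteqP; split=> [_ [_ /woven_code[x <-] <-]|x Xx].
    by rewrite first_code; exact: set_mem (valP x).
  exists (code m.+1 (exist _ x (mem_set Xx) : X)); first exact: code_woven.
  exact: first_code.
- move=> _ [_ /woven_code[x <-] <-]; rewrite image_code.
  exact: set_mem (valP (phi x)).
- move=> _ x /woven_code[y <-]; rewrite first_code => /val_inj <-.
  by rewrite image_code.
Qed.

End OneSidedMarkov.

Lemma SFT_upper_pL (A : finType) (X : subshift A) (phi : X -> X) :
  (1 < #|A|)%N -> endomorphism phi -> onto phi -> SFT X ->
  determining phi [set i | i <= 0] [set j | 0 <= j] -> essentially pL phi.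
Proof.
move=> hA ephi phi_onto [B [G [lambda [_ /conjugacyP[bl [kappa lk kl]]]]]] dphi.
have [A' [Y [psi [theta [_ [epsi psi_onto] psi1 /conjugacyP[bt [eta te et]] tphi]]]]] :=
  upper_one_sided hA ephi phi_onto dphi.
have be := block_code_inverse bt te et.
have [m Ym] : exists m, finite_type Y m.
  apply: (@conj_finite_type _ _ _ G (lambda \o eta)).
    exact: (block_code_comp (f := val \o lambda)).
  by exists (theta \o kappa) => x /=; rewrite ?lk ?et// te kl.
have [c [cE bc cbij]] := finite_type_code Ym.
have [chi [echi chi_onto cpsi]] := conjugate_endomorphism bc cbij epsi psi_onto.
have [l lP] := one_sided_code epsi cE cbij cpsi psi1.
exists _, (rauzy Y m), chi, (c \o theta); split=> //.
- exact: rauzy_nondegenerate.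
- apply: (@one_sided_pL _ _ _ echi chi_onto _ l) => [a|x y xy].
    by exists (c (rep a)); rewrite cE /code shift_on0 repK.
  by apply: lP => k kl'; apply: xy; exact: leqW.
- apply/conjugacyP; split; first exact: (block_code_comp (f := val \o c)).
  by apply: bij_comp => //; exists eta.
- by move=> x; rewrite /= tphi cpsi.
Qed.

(** * The equivalences for p-L *)

Lemma weakly_pL_iff (A : finType) (X : subshift A) (phi : X -> X) :
  (1 < #|A|)%N -> endomorphism phi -> onto phi ->
  (essentially_weakly weakly_pL phi /\ determining phi setT [set j | 0 <= j] <->
   determining phi [set i | i <= 0] [set j | 0 <= j]).
Proof.
move=> hA ephi phi_onto; split.
  move=> [[A' [X' [phi' [theta [_ ephi' pL' ct tphi]]]]] dphi].
  exact: conj_weakly_pL_upper ct tphi pL' dphi.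
move=> dphi; split; last by move=> x y ox oy xy; apply: dphi => // i j _; exact: xy.
have [A' [Y [psi [theta [hA' [epsi _] psi1 ct tphi]]]]] :=
  upper_one_sided hA ephi phi_onto dphi.
by exists A', Y, psi, theta; split=> //; exact: one_sided_weakly_pL.
Qed.

Lemma pL_iff (A : finType) (X : subshift A) (phi : X -> X) :
  (1 < #|A|)%N -> endomorphism phi -> onto phi -> SFT X ->
  (essentially pL phi /\ determining phi setT [set j | 0 <= j] <->
   determining phi [set i | i <= 0] [set j | 0 <= j]).
Proof.
move=> hA ephi phi_onto sft; split.
  move=> [[A' [G [phi' [theta [_ [ephi' _] pL' ct tphi]]]]] dphi].
  exact: conj_weakly_pL_upper ct tphi (strong_weak_pL pL') dphi.
move=> dphi; split; last by move=> x y ox oy xy; apply: dphi => // i j _; exact: xy.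
exact: SFT_upper_pL.
Qed.

(** * Reversal of the columns *)

Definition mir (A : finType) (x : fullshift A) : fullshift A := fun j => x (- j).

Lemma mirK (A : finType) : involutive (@mir A).
Proof. by move=> x; apply/funext => j; rewrite /mir opprK. Qed.

Lemma mir_shift (A : finType) (j : int) (x : fullshift A) :
  mir (shift j x) = shift (- j) (mir x).
Proof. by apply/funext => k; rewrite /mir /shift opprD opprK. Qed.

Lemma agree_mir (A : finType) (k : nat) (x y : fullshift A) :
  agree k x y -> agree k (mir x) (mir y).
Proof. by move=> xy j jk; apply: xy; rewrite abszN. Qed.

Definition mirror_points (A : finType) (X Y : set (fullshift A)) : Prop :=
  forall x, Y x <-> X (mir x).

Section MirrorSubshift.
Variables (A : finType) (X : subshift A).

Lemma closed_mirror : closed [set x | points X (mir x)].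
Proof.
apply/closed_ulim => u x uX ux.
apply: ((closed_ulim _).1 (@closed_points _ X)) uX _ => k.
by apply: filterS (ux k) => n; exact: agree_mir.
Qed.

Lemma shift_mirror :
  shift 1 @` [set x | points X (mir x)] = [set x | points X (mir x)].
Proof.
have shiftX j x : points X (mir x) -> points X (mir (shift j x)).
  move=> Xx; rewrite mir_shift.
  exact: set_mem (shift_mem (- j) (mem_set Xx)).
apply/seteqP; split=> [_ [x /= Xx <-]|x Xx]; first exact: shiftX.
by exists (shift (-1) x); [exact: shiftX|rewrite shiftD subrr shift0].
Qed.

Definition mirror_subshift : subshift A := Subshift closed_mirror shift_mirror.

End MirrorSubshift.

(** A relation rather than a construction: the mirror of [path_shift G] must be
    [path_shift (op_graph G)] itself, not merely a subshift with the same
    points. *)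
Definition mirrors (A : finType) (X Y : subshift A) (phi : X -> X)
    (psi : Y -> Y) : Prop :=
  mirror_points X Y /\
  forall (x : X) (y : Y), val y = mir (val x) -> val (psi y) = mir (val (phi x)).

Section Mirror.
Variables (A : finType) (X Y : subshift A).
Implicit Types (phi : X -> X) (psi : Y -> Y).

Lemma mirror_pointsC : mirror_points X Y -> mirror_points Y X.
Proof. by move=> XY x; rewrite XY mirK. Qed.

Lemma mirror_point : mirror_points X Y -> forall x : X,
  {y : Y | val y = mir (val x)}.
Proof.
move=> XY x; have Yx : mir (val x) \in points Y.
  by rewrite inE; apply/XY; rewrite mirK; exact: set_mem (valP x).
by exists (exist _ (mir (val x)) Yx).
Qed.

Lemma mirrorsC phi psi : mirrors phi psi -> mirrors psi phi.
Proof.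
move=> [XY pp]; split=> [|y x xy]; first exact: mirror_pointsC.
by rewrite (pp x y) ?mirK// xy mirK.
Qed.

End Mirror.

Lemma mirrors_ex (A : finType) (X Y : subshift A) (phi : X -> X) :
  mirror_points X Y -> exists psi : Y -> Y, mirrors phi psi.
Proof.
move=> XY; have YX := mirror_pointsC XY.
exists (fun y => projT1 (mirror_point XY (phi (projT1 (mirror_point YX y))))).
split=> // x y xy; case: (mirror_point XY) => z /= ->.
case: (mirror_point YX) => x' /=; rewrite xy mirK => /val_inj ->.
by [].
Qed.

Section MirrorTransfer.
Variables (A : finType) (X Y : subshift A).

Lemma mirror_block_code (C : finType) (f : X -> fullshift C)
    (g : Y -> fullshift C) :
  mirror_points X Y ->
  (forall x y, val y = mir (val x) -> g y = mir (f x)) ->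
  block_code f -> block_code g.
Proof.
move=> XY fg bf; have YX := mirror_pointsC XY; split=> [y|].
  have [x xy] := mirror_point YX y.
  rewrite (fg (shift_on (-1) x)); last by rewrite /= mir_shift xy mirK.
  by rewrite (block_code_shift bf) mir_shift (fg x y)// xy mirK.
have [k kf] := block_code_local bf; exists k => y y'.
have [x xy] := mirror_point YX y; have [x' xy'] := mirror_point YX y'.
move=> yy'; rewrite (fg x y) ?(fg x' y'); [|by rewrite xy' mirK|by rewrite xy mirK].
by rewrite /mir oppr0; apply: kf; rewrite xy xy'; exact: agree_mir.
Qed.

Variables (phi : X -> X) (psi : Y -> Y).
Hypothesis pp : mirrors phi psi.
Let XY : mirror_points X Y := pp.1.
Let YX : mirror_points Y X := mirror_pointsC XY.

Lemma mirror_endomorphism : endomorphism phi -> endomorphism psi.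
Proof.
move=> /endomorphismP bphi; apply/endomorphismP.
by apply: mirror_block_code bphi => // x y xy /=; exact: pp.2.
Qed.

Lemma mirror_onto : onto phi -> onto psi.
Proof.
move=> phi_onto y; have [x xy] := mirror_point YX y.
have [x' phix'] := phi_onto x; have [y' xy'] := mirror_point XY x'.
by exists y'; apply: val_inj; rewrite (pp.2 x' y')// phix' xy mirK.
Qed.

Lemma mirror_determining (I J J' : set int) :
  (forall j, J' j <-> J (- j)) -> determining phi I J -> determining psi I J'.
Proof.
move=> JJ' dphi y y' oy oy' yy'.
pose m (z : int -> Y) i : X := projT1 (mirror_point YX (z i)).
have mE z i : val (m z i) = mir (val (z i)) by rewrite /m; case: mirror_point.
have orb z : orbit_of psi z -> orbit_of phi (m z).
  move=> oz i; apply: val_inj; rewrite ((mirrorsC pp).2 (z i)) ?mE//.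
  by rewrite oz.
have myy' : m y = m y'.
  apply: dphi => [||i j Ii Jj]; [exact: orb|exact: orb|].
  by rewrite !mE; apply: yy' => //; apply/JJ'; rewrite opprK.
apply/funext => i; apply/val_inj/(can_inj (@mirK A)).
by rewrite -!mE myy'.
Qed.

End MirrorTransfer.

Lemma mirror_conjugacy (A B : finType) (X Y : subshift A) (X' Y' : subshift B)
    (phi : X -> X) (psi : Y -> Y) (phi' : X' -> X') (psi' : Y' -> Y')
    (theta : X -> X') :
  mirrors phi psi -> mirrors phi' psi' -> conjugacy theta ->
  (forall x, theta (phi x) = phi' (theta x)) ->
  exists theta' : Y -> Y', conjugacy theta' /\
    forall y, theta' (psi y) = psi' (theta' y).
Proof.
move=> [XY pp] [XY' pp'] /conjugacyP[bt [eta te et]] tphi.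
have YX := mirror_pointsC XY; have YX' := mirror_pointsC XY'.
pose theta' y := projT1 (mirror_point XY' (theta (projT1 (mirror_point YX y)))).
pose eta' y := projT1 (mirror_point XY (eta (projT1 (mirror_point YX' y)))).
have tE x y : val y = mir (val x) -> val (theta' y) = mir (val (theta x)).
  move=> xy; rewrite /theta'; case: (mirror_point XY') => z /= ->.
  by case: mirror_point => x' /=; rewrite xy mirK => /val_inj ->.
have eE x y : val y = mir (val x) -> val (eta' y) = mir (val (eta x)).
  move=> xy; rewrite /eta'; case: (mirror_point XY) => z /= ->.
  by case: mirror_point => x' /=; rewrite xy mirK => /val_inj ->.
exists theta'; split.
  apply/conjugacyP; split; first exact: mirror_block_code bt.
  exists eta' => y; apply: val_inj.
    have [x xy] := mirror_point YX y.
    have yx : val y = mir (val x) by rewrite xy mirK.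
    by rewrite (eE (theta x)) ?te// (tE x).
  have [x xy] := mirror_point YX' y.
  have yx : val y = mir (val x) by rewrite xy mirK.
  by rewrite (tE (eta x)) ?et// (eE x).
move=> y; have [x xy] := mirror_point YX y.
have yx : val y = mir (val x) by rewrite xy mirK.
apply: val_inj; rewrite (tE (phi x)); last exact: pp.
by rewrite tphi (pp' (theta x))//; exact: tE.
Qed.

Definition op_graph (A : finType) (G : graph A) : graph A :=
  @Graph A (vertex G) (@ter A G) (@ini A G).

Definition op_hom (B A : finType) (Gamma : graph B) (G : graph A)
    (h : graph_hom Gamma G) : graph_hom (op_graph Gamma) (op_graph G) :=
  @GraphHom _ _ (op_graph Gamma) (op_graph G) _ _ (ter_map h) (ini_map h).

Definition op_textile (B A : finType) (Gamma : graph B) (G : graph A)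
    (T : textile Gamma G) : textile (op_graph Gamma) (op_graph G) :=
  Textile (op_hom (tp T)) (op_hom (tq T)).

Definition opposite (P Q : textile_property) : Prop :=
  forall (B A : finType) (Gamma : graph B) (G : graph A)
    (T : textile Gamma G), P _ _ _ _ T -> Q _ _ _ _ (op_textile T).

Lemma op_paths (A : finType) (G : graph A) :
  mirror_points (paths G) (paths (op_graph G)).
Proof.
have half (H : graph A) (x : fullshift A) : paths (op_graph H) x -> paths H (mir x).
  move=> Hx j; rewrite /mir; have := Hx (- (j + 1)).
  by rewrite opprD addrNK => /esym.
move=> x; split=> [/half//|Gx].
by rewrite -[x]mirK; apply: half; case: G Gx.
Qed.

Lemma op_woven (B A : finType) (Gamma : graph B) (G : graph A)
    (T : textile Gamma G) : mirror_points (woven T) (woven (op_textile T)).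
Proof.
move=> z; split=> [[zs [zsP <- zsq]]|[zs [zsP zs0 zsq]]].
  exists (fun i => mir (zs i)); split=> // i; first exact/op_paths.
  by have := congr1 (@mir A) (zsq i).
exists (fun i => mir (zs i)); split=> [i||i].
- by apply/op_paths; rewrite mirK.
- by rewrite zs0 mirK.
- by have := congr1 (@mir A) (zsq i).
Qed.

Lemma op_represents (B A : finType) (Gamma : graph B) (G : graph A)
    (T : textile Gamma G) (Z W : set (fullshift B)) (X Y : subshift A)
    (phi : X -> X) (psi : Y -> Y) :
  mirror_points Z W -> mirrors phi psi ->
  represents T Z phi -> represents (op_textile T) W psi.
Proof.
move=> ZW [XY pp] [pinj pZ qZ qphi].
have opE (h : graph_hom Gamma G) w :
    block_map (op_hom h) w = mir (block_map h (mir w)).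
  by apply/funext => j; rewrite /mir /block_map opprK.
split.
- move=> w w'; rewrite !inE => /ZW Zw /ZW Zw'; rewrite !opE.
  move=> /(can_inj (@mirK A)) /pinj ww'.
  by apply/(can_inj (@mirK B))/ww'; rewrite inE.
- apply/seteqP; split=> [_ [w /ZW Zw <-]|y /XY Xy].
    by apply/XY; rewrite opE mirK -pZ; exists (mir w).
  move: Xy; rewrite -pZ => -[z Zz zy]; exists (mir z).
    by apply/ZW; rewrite mirK.
  by rewrite opE mirK zy mirK.
- move=> _ [w /ZW Zw <-]; apply/XY; rewrite opE mirK.
  by apply: qZ; exists (mir w).
- move=> w y /ZW Zw; rewrite !opE => wy.
  have [x xy] := mirror_point (mirror_pointsC XY) y.
  rewrite (pp x y); last by rewrite xy mirK.
  by rewrite (qphi (mir w))// xy -wy mirK.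
Qed.

Lemma mirror_essentially_weakly (P Q : textile_property) (A : finType)
    (X Y : subshift A) (phi : X -> X) (psi : Y -> Y) :
  opposite P Q -> mirrors phi psi ->
  essentially_weakly P phi -> essentially_weakly Q psi.
Proof.
move=> PQ pp [A' [X' [phi' [theta [hA' ephi' P' ct tphi]]]]].
have XY' : mirror_points X' (mirror_subshift X') by [].
have [psi' pp'] := mirrors_ex phi' XY'.
have [theta' [ct' tpsi]] := mirror_conjugacy pp pp' ct tphi.
exists A', (mirror_subshift X'), psi', theta'; split=> //.
  exact: mirror_endomorphism pp' ephi'.
have [B [Gamma [G [T [Z [PT ZG repr]]]]]] := P'.
exists B, (op_graph Gamma), (op_graph G), (op_textile T), (mirror_subshift Z).
split; [exact: PQ|by move=> z /ZG /op_paths|].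
exact: op_represents repr.
Qed.

Lemma mirror_essentially (P Q : textile_property) (A : finType)
    (X Y : subshift A) (phi : X -> X) (psi : Y -> Y) :
  opposite P Q -> mirrors phi psi -> essentially P phi -> essentially Q psi.
Proof.
move=> PQ pp [A' [G [phi' [theta [[Gini Gter] [ephi' phi'_onto] P' ct tphi]]]]].
have XY' : mirror_points (path_shift G) (path_shift (op_graph G)) := op_paths G.
have [psi' pp'] := mirrors_ex phi' XY'.
have [theta' [ct' tpsi]] := mirror_conjugacy pp pp' ct tphi.
exists A', (op_graph G), psi', theta'; split=> //.
  by split; [exact: mirror_endomorphism pp' ephi'|exact: mirror_onto pp' _].
have [B [Gamma [T [PT repr]]]] := P'.
exists B, (op_graph Gamma), (op_textile T); split; first exact: PQ.
exact: op_represents (@op_woven _ _ _ _ T) pp' repr.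
Qed.

Lemma mirror_SFT (A : finType) (X Y : subshift A) :
  mirror_points X Y -> SFT X -> SFT Y.
Proof.
move=> XY [B [G [theta [[Gini Gter] ct]]]].
have XY' : mirror_points (path_shift G) (path_shift (op_graph G)) := op_paths G.
have [theta' [ct' _]] := @mirror_conjugacy _ _ _ _ _ _ id id id id theta
  (conj XY (fun _ _ => id)) (conj XY' (fun _ _ => id)) ct (fun=> erefl).
by exists B, (op_graph G), theta'.
Qed.

(** EL and ER stand for a left-resolving property of the mirrored endomorphism
    psi and the corresponding right-resolving property of phi. *)
Lemma mirror_iff (A : finType) (X Y : subshift A) (phi : X -> X)
    (psi : Y -> Y) (EL ER : Prop) :
  mirrors phi psi -> (EL <-> ER) ->
  (EL /\ determining psi setT [set j | 0 <= j] <->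
   determining psi [set i | i <= 0] [set j | 0 <= j]) ->
  (ER /\ determining phi setT [set j | j <= 0] <->
   determining phi [set i | i <= 0] [set j | j <= 0]).
Proof.
move=> pp ELR.
have JJ' j : [set j : int | 0 <= j] j <-> [set j : int | j <= 0] (- j).
  by rewrite /= oppr_le0.
have JJ j : [set j : int | j <= 0] j <-> [set j : int | 0 <= j] (- j).
  by rewrite /= oppr_ge0.
have flip I : determining psi I [set j | 0 <= j] <->
              determining phi I [set j | j <= 0].
  by split; [exact: mirror_determining (mirrorsC pp) _ _ _ JJ
            |exact: mirror_determining pp _ _ _ JJ'].
by rewrite ELR !flip.
Qed.

Theorem theorem8p10 (R : realType) (A : finType) (hA : (1 < #|A|)%N)
    (X : subshift A) (d : X -> X -> R) (hd : compatible_metric d)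
    (phi : X -> X) (hphi : endomorphism phi) (phi_onto : onto phi) :
  ((essentially_weakly weakly_pL phi /\ right_expansive d phi <->
      right_expansive_upper d phi) /\
   (essentially_weakly weakly_pR phi /\ left_expansive d phi <->
      left_expansive_upper d phi)) /\
  (SFT X ->
   (essentially pL phi /\ right_expansive d phi <->
      right_expansive_upper d phi) /\
   (essentially pR phi /\ left_expansive d phi <->
      left_expansive_upper d phi)).
Proof.
have bphi := (endomorphismP _).1 hphi.
rewrite /right_expansive /right_expansive_upper.
rewrite /left_expansive /left_expansive_upper.
rewrite !(expansive_onP hd _ bphi nonneg_absorbing).
rewrite !(expansive_onP hd _ bphi nonpos_absorbing).
have XY : mirror_points X (mirror_subshift X) by [].
have [psi pp] := mirrors_ex phi XY.
have epsi := mirror_endomorphism pp hphi.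
have psi_onto := mirror_onto pp phi_onto.
have wLR : opposite weakly_pL weakly_pR by [].
have wRL : opposite weakly_pR weakly_pL by [].
have LR : opposite pL pR by [].
have RL : opposite pR pL by [].
split; first split.
- exact: weakly_pL_iff.
- apply: (mirror_iff pp) (weakly_pL_iff hA epsi psi_onto).
  split; first exact: mirror_essentially_weakly wLR (mirrorsC pp).
  exact: mirror_essentially_weakly wRL pp.
- move=> sft; split; first exact: pL_iff.
  apply: (mirror_iff pp) (pL_iff hA epsi psi_onto (mirror_SFT XY sft)).
  split; first exact: mirror_essentially LR (mirrorsC pp).
  exact: mirror_essentially RL pp.
Qed.
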